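(* Let $k\ge 1$ be an integer. Let $X_n$ and $Y_n$ ($n\ge1$) be sequences of random finitely generated abelian groups. Let $a$ be a positive integer and let $\mathcal{A}_a$ be the set of isomorphism classes of finite abelian groups with exponent dividing $a$. Suppose that for every $G\in\mathcal{A}_a$, $$\lim_{n\to\infty}\mathbf{E}[\#\mathrm{Sur}(X_n,G)]=\lim_{n\to\infty}\mathbf{E}[\#\mathrm{Sur}(Y_n,G)]=n_k(G).$$ Then for every $H\in\mathcal{A}_a$ the limit $\lim_{n\to\infty}\mathbf{P}(X_n\otimes(\mathbb{Z}/a\mathbb{Z})\simeq H)$ exists, and for every $G\in\mathcal{A}_a$ $$\sum_{H\in\mathcal{A}_a}\lim_{n\to\infty}\mathbf{P}\big(X_n\otimes(\mathbb{Z}/a\mathbb{Z})\simeq H\big)\,\#\mathrm{Sur}(H,G)=n_k(G).$$ Furthermore, for every $H\in\mathcal{A}_a$, $$\lim_{n\to\infty}\mathbf{P}\big(X_n\otimes(\mathbb{Z}/a\mathbb{Z})\simeq H\big)=\lim_{n\to\infty}\mathbf{P}\big(Y_n\otimes(\mathbb{Z}/a\mathbb{Z})\simeq H\big).$$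
   Context: $\mathrm{Sur}(A,B)$ is the set of surjective group homomorphisms $A\to B$. For a finite abelian group $G$, $n_k(G)$ is the number of sequences of nested subgroups $0=H_0\le H_1\le\cdots\le H_{k-1}\le H_k=G$. *)

(* Defs.v *)
From HB Require Import structures.
From mathcomp Require Import all_boot all_order all_algebra all_fingroup.
From mathcomp Require Import all_solvable.
From mathcomp Require Import finmap ring_quotient freeg.
From mathcomp Require Import all_classical all_reals all_analysis.

Set Implicit Arguments.
Unset Strict Implicit.
Unset Printing Implicit Defensive.

Import Order.TTheory GRing.Theory Num.Theory.

Local Open Scope ring_scope.

(* Abelian groups are written additively: they are the zmodTypes. *)

Definition zmod_iso (A B : zmodType) : Prop :=
  exists2 f : A -> B, GRing.zmod_morphism f & bijective f.

(* The finGroupType structure on a finZmodType is its additive group, so 1%G is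
   the zero subgroup and [exponent] below is the additive exponent. *)
Definition n_chains (k : nat) (G : finZmodType) : nat :=
  #|[set H : {ffun 'I_k.+1 -> {group G}} |
      [&& H ord0 == 1%G, H ord_max == [set: G]%G
        & [forall i : 'I_k,
             H (widen_ord (leqnSn k) i) \subset H (fintype.lift ord0 i)]]]|.

Definition exponent_dvd (a : nat) (G : finZmodType) : Prop :=
  (exponent [set: G]%SET %| a)%N.

Local Open Scope classical_set_scope.

Definition finitely_generated (A : zmodType) : Prop :=
  exists (r : nat) (g : 'I_r -> A),
    forall x : A, exists c : 'I_r -> int, x = \sum_(i < r) g i *~ c i.

Record fgAbGroup := FgAbGroup {
  fg_sort :> zmodType;
  fg_sortP : finitely_generated fg_sort }.

Definition Sur (A B : zmodType) : set (A -> B) :=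
  [set f | GRing.zmod_morphism f /\ set_surj [set: A] [set: B] f].
Arguments Sur : clear implicits.

(* [fset_set] is meaningful on finite sets only, see [finite_Sur] below. *)
Definition nSur (A B : zmodType) : nat := #|` fset_set (Sur A B)|%fset.

(* The ordinals below n.+1 carry addition modulo n.+1. The library's 'Z_a is
   not used, because 'Z_1 is the group with two elements. *)
Definition Zmod (a : nat) : finZmodType := 'I_a.-1.+1.

(* Tensor product of abelian groups: the free abelian group on A * B modulo
   the subgroup generated by the biadditivity relators. *)

Section GeneratedSubgroup.
Variables (V : zmodType) (S : set V).

Definition gen_subgroup : {pred V} := fun x =>
  `[< forall K : {pred V}, GRing.zmod_closed K ->
        (forall s, S s -> s \in K) -> x \in K >].

Lemma gen_subgroup_closed : GRing.zmod_closed gen_subgroup.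
Proof.
split=> [|x y /asboolP hx /asboolP hy]; apply/asboolP => K KZ SK.
  exact: (proj1 KZ).
by apply: (proj2 KZ); [exact: hx | exact: hy].
Qed.

HB.instance Definition _ :=
  GRing.isZmodClosed.Build V gen_subgroup gen_subgroup_closed.

End GeneratedSubgroup.

Section Tensor.
Variables A B : zmodType.

Definition biadditive (C : zmodType) (f : A -> B -> C) : Prop :=
  (forall a a' b, f (a + a') b = f a b + f a' b) /\
  (forall a b b', f a (b + b') = f a b + f a b').

Definition free_tensor : zmodType := {freeg (A * B)%type / int}.

Definition free_pure (a : A) (b : B) : free_tensor := << (a, b) >>.

Definition tensor_relators : set free_tensor :=
  [set x | exists a a' b,
     x = free_pure (a + a') b - free_pure a b - free_pure a' b] `|`
  [set x | exists a b b',
     x = free_pure a (b + b') - free_pure a b - free_pure a b'].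

Definition tensor : zmodType := Quotient.quot (gen_subgroup tensor_relators).

Definition pure_tensor (a : A) (b : B) : tensor := (\pi_tensor (free_pure a b))%qT.

Lemma pure_tensor_biadditive : biadditive pure_tensor.
Proof.
pose I : zmodClosed _ := gen_subgroup tensor_relators.
have relI x : tensor_relators x -> x \in I.
  by move=> Rx; apply/asboolP => K _ SK; exact: SK.
split=> [a a' b|a b b'];
  apply/eqP; rewrite /pure_tensor -[X in _ == X]raddfD /=;
  rewrite -(Quotient.idealrBE I) opprD addrA; apply: relI.
- by left; exists a, a', b.
- by right; exists a, b, b'.
Qed.

Lemma tensor_universal (C : zmodType) (f : A -> B -> C) : biadditive f ->
  exists! h : tensor -> C,
    GRing.zmod_morphism h /\ forall a b, h (pure_tensor a b) = f a b.
Proof.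
move=> [fDl fDr].
pose I : zmodClosed _ := gen_subgroup tensor_relators.
pose L (x : free_tensor) : C :=
  fglift (fun p => f p.1 p.2 : zmodule C) x.
have LB : GRing.zmod_morphism L.
  exact: (lift_is_additive (fun p => f p.1 p.2 : zmodule C)).
have LU a b : L (free_pure a b) = f a b by rewrite /L liftU scale1r.
have L0 x : x \in I -> L x = 0.
  move=> /asboolP/(_ (fun x => L x == 0)) hx.
  apply/eqP; apply: hx.
  - split; first by rewrite unfold_in; have := LB 0 0; rewrite !subrr => ->.
    by move=> y z; rewrite !unfold_in LB => /eqP-> /eqP->; rewrite subrr.
  - move=> s [[a [a' [b ->]]]|[a [b [b' ->]]]]; rewrite unfold_in !LB !LU.
    + by rewrite fDl -addrA -opprD subrr.
    + by rewrite fDr -addrA -opprD subrr.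
pose h (t : tensor) : C := L (generic_quotient.repr t).
have hpi x : h (\pi_tensor x)%qT = L x.
  apply/eqP; rewrite -subr_eq0 -LB; apply/eqP/L0.
  by rewrite (Quotient.idealrBE I) reprK.
exists h; split.
  split=> [s t|a b]; last by rewrite hpi LU.
  by rewrite -[s]reprK -[t]reprK -raddfB !hpi LB.
move=> h' [h'B h'U]; apply/funext => t; rewrite -[t]reprK hpi.
move: (generic_quotient.repr t) => x; rewrite -[x]freeg_sumE.
pose FL := GRing.isZmodMorphism.Build free_tensor C L LB.
pose aL : {additive free_tensor -> C} := HB.pack L FL.
pose Fh := GRing.isZmodMorphism.Build tensor C h' h'B.
pose ah : {additive tensor -> C} := HB.pack h' Fh.
rewrite -[L]/(aL : _ -> _) -[h']/(ah : _ -> _) !raddf_sum.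
apply: eq_bigr => -[a b] _; set c := coeff _ _.
have -> : << c *g (a, b) >> = free_pure a b *~ c :> free_tensor.
  by rewrite freegU_mulz intz.
by rewrite !raddfMz /= LU h'U.
Qed.

End Tensor.
Arguments tensor_relators : clear implicits.

(* A family containing exactly one member of each isomorphism class of finite
   abelian groups with exponent dividing a; such families exist by
   [iso_class_reps_exist]. *)
Definition iso_class_reps (a : nat) (I : Type) (S : I -> finZmodType) : Prop :=
  (forall i, exponent_dvd a (S i)) /\
  (forall G : finZmodType, exponent_dvd a G -> exists! i, zmod_iso G (S i)).

Section Facts.

Lemma finite_Sur (A : fgAbGroup) (B : finZmodType) : finite_set (Sur A B).
Proof.
case: A => A /= [r [g hg]].
pose ev (f : A -> B) : {ffun 'I_r -> B} := [ffun i => f (g i)].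
have inj : {in Sur A B &, injective ev}.
  move=> f1 f2 /set_mem[f1M _] /set_mem[f2M _] /ffunP e12.
  apply/funext => x; have [c ->] := hg x.
  pose F1 := GRing.isZmodMorphism.Build A B f1 f1M.
  pose F2 := GRing.isZmodMorphism.Build A B f2 f2M.
  pose a1 : {additive A -> B} := HB.pack f1 F1.
  pose a2 : {additive A -> B} := HB.pack f2 F2.
  rewrite -[f1]/(a1 : A -> B) -[f2]/(a2 : A -> B) !raddf_sum.
  apply: eq_bigr => i _; rewrite !raddfMz.
  by have := e12 i; rewrite !ffunE /= => ->.
have := inj_card_eq inj; rewrite card_eq_sym => /card_eqPle[le _].
exact: card_le_finite le finite_finset.
Qed.

Lemma zmod_iso_refl (A : zmodType) : zmod_iso A A.
Proof. by exists id => //; exists id. Qed.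

Lemma zmod_iso_sym (A B : zmodType) : zmod_iso A B -> zmod_iso B A.
Proof.
move=> [f fB [g fK gK]]; exists g; last by exists f.
by move=> x y; apply: (can_inj fK); rewrite gK fB !gK.
Qed.

Lemma zmod_iso_trans (A B C : zmodType) :
  zmod_iso A B -> zmod_iso B C -> zmod_iso A C.
Proof.
move=> [f fB bf] [g gB bg]; exists (g \o f); last exact: bij_comp.
by move=> x y /=; rewrite fB gB.
Qed.

Lemma iso_class_reps_exist (a : nat) :
  exists (I : countType) (S : I -> finZmodType), iso_class_reps a S.
Proof.
pose code := {n : nat & {ffun 'I_n * 'I_n -> 'I_n}}.
pose codeP (c : code) (G : finZmodType) := exponent_dvd a G /\
  exists2 f : G -> 'I_(tag c), bijective f &
    forall x y, f (x - y) = tagged c (f x, f y).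
have codeE c G H : codeP c G -> codeP c H -> zmod_iso G H.
  move=> [_ [f [f' fK f'K] fB]] [_ [h [h' hK h'K] hB]].
  exists (h' \o f); last first.
    by exists (f' \o h) => x /=; rewrite ?h'K ?fK ?f'K ?hK.
  by move=> x y /=; rewrite fB -{1}[f x]h'K -{1}[f y]h'K -hB hK.
have codeG G : exponent_dvd a G -> exists c, codeP c G.
  move=> aG; exists (Tagged (fun n => {ffun 'I_n * 'I_n -> 'I_n})
    [ffun p : 'I_#|G| * 'I_#|G| =>
      enum_rank (enum_val p.1 - enum_val p.2 : G)]).
  split=> //; exists (@enum_rank G); first exact: enum_rank_bij.
  by move=> x y; rewrite /= ffunE /= !enum_rankK.
pose canon (c : code) := `[< exists2 G, codeP c G &
  forall G' c', codeP c' G' -> zmod_iso G G' -> (choice.pickle c <= choice.pickle c')%N >].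
pose I : countType := {c : code | canon c}.
have repP (i : I) : exists G, codeP (val i) G.
  by case/asboolP: (valP i) => G Gi _; exists G.
pose S (i : I) := projT1 (cid (repP i)).
have SP i : codeP (val i) (S i) := projT2 (cid (repP i)).
exists I, S; split=> [i|G aG]; first exact: (SP i).1.
pose cls : pred nat := fun n =>
  `[< exists c G', [/\ codeP c G', zmod_iso G G' & choice.pickle c = n] >].
have : exists n, cls n.
  have [c cG] := codeG G aG; exists (choice.pickle c); apply/asboolP.
  by exists c, G; split=> //; exact: zmod_iso_refl.
case/ex_minnP => n /asboolP[c [G' [cG' GG' <-]]] cmin.
have cI : canon c.
  apply/asboolP; exists G' => // G2 c2 c2G2 G'G2; apply: cmin; apply/asboolP.
  by exists c2, G2; split=> //; exact: zmod_iso_trans GG' G'G2.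
exists (exist _ c cI); split.
  by apply: (zmod_iso_trans GG'); exact: codeE cG' (SP (exist _ c cI)).
move=> j GSj; apply: val_inj => /=.
have SjG : zmod_iso (S j) G by exact: zmod_iso_sym.
have /asboolP[G0 jG0 G0min] := valP j.
have G0S : zmod_iso G0 (S j) := codeE _ _ _ jG0 (SP j).
have G0G : zmod_iso G0 G := zmod_iso_trans G0S SjG.
apply: (pcan_inj choice.pickleK); apply/eqP; rewrite eqn_leq; apply/andP; split.
  by apply: cmin; apply/asboolP; exists (val j), (S j); split=> //; exact: SP.
by apply: G0min cG' _; exact: zmod_iso_trans G0G GG'.
Qed.

End Facts.

Definition iso_invariant (C : fgAbGroup -> Prop) : Prop :=
  forall A B : fgAbGroup, zmod_iso A B -> C A -> C B.

(* The isomorphism class of X is a random variable with values in the countable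
   set of isomorphism classes, equipped with its discrete sigma-algebra. *)
Definition random_group (d : measure_display) (T : measurableType d)
    (X : T -> fgAbGroup) : Prop :=
  forall C : fgAbGroup -> Prop, iso_invariant C -> measurable [set w | C (X w)].

Section RandomGroup.
Variables (R : realType) (d : measure_display) (T : measurableType d).
Variables (P : probability T R) (X : T -> fgAbGroup).

Definition surj_moment (G : finZmodType) : \bar R :=
  'E_P[fun w => (nSur (X w) G)%:R]%E.

Definition tensor_prob (a : nat) (H : finZmodType) : \bar R :=
  P [set w | zmod_iso (tensor (X w) (Zmod a)) H].

End RandomGroup.

(* Main.v *)
(* Idea. Let z_p(A) = #Hom(A, F_p), a power of p. The mixed moments
   E[#Hom(X_n, G) z_p(X_n)^m] = E[#Hom(X_n, G x F_p^m)] converge, and their limits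
   are at most the number of chains of k subgroups of G x F_p^m, which is
   p^(m^2 k / (2(k+1)) + O(m)). The Lagrange polynomial of degree m with nodes
   1, p, ..., p^m that approximates the indicator of z_p = p^s differs from it by at
   most C^m p^(-m^2/2) z_p^m at every power of p. As k/(k+1) < 1, the error tends to
   0 on average, so every moment restricted to the event z_p(X_n) = z_p(K) converges.
   Doing this for all primes p dividing a leaves, by a Frattini argument, finitely
   many isomorphism classes, on which the matrix #Sur(H, K) is triangular: the
   probabilities converge. Large groups are controlled by the moments
   E[#Hom(X_n, G) z_p(X_n)], so no mass escapes from the limiting moments.
   Interleaving the two sequences shows that their limits agree. *)
Require Import Defs.
From HB Require Import structures.
From mathcomp Require Import all_boot all_order all_algebra all_fingroup.
From mathcomp Require Import all_solvable.
From mathcomp Require Import zify ring lra.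

Set Implicit Arguments.
Unset Strict Implicit.
Unset Printing Implicit Defensive.

Import Order.TTheory GRing.Theory Num.Theory.

(** * Chains of subgroups *)

(** The obstacle is the size of the moments: E[z_p^m] can grow like p^(c m^2), far outside the range
    of Carleman-type criteria, so the law can be recovered only because the values of z_p are as
    sparse as the powers of p. Interpolation at the nodes 1, p, ..., p^m gains p^(-m^2/2) from its
    denominators, hence the chain count must have a quadratic constant strictly below 1/2. The
    constant k/(2(k+1)) is the maximum of the second elementary symmetric polynomial of k+1
    nonnegative numbers of sum 1. It arises from peeling off one subgroup of index p at a time: each
    of the m steps chooses which of the k members is the first to leave the subgroup, or none, and a
    step at position j pays a factor p for every earlier step at a position i < j. Only pairs of
    distinct positions are paid for, whence the symmetric polynomial. Convergence comes from
    Cauchy's criterion applied to approximations, so no limit measure has to be extracted. *)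

Section ChainCounting.
Local Open Scope nat_scope.
Local Open Scope group_scope.

(** Unlike in [n_chains], no end of the chain is pinned: this count belongs to homomorphisms as
    [n_chains] belongs to surjections. *)
Definition chains (gT : finGroupType) (k : nat) (E : {set gT}) :=
  [set B : {ffun 'I_k -> {group gT}} |
    [forall i, B i \subset E] &&
    [forall i : 'I_k, forall j : 'I_k, (i <= j)%N ==> (B i \subset B j)]].

Lemma chainsP (gT : finGroupType) (k : nat) (E : {set gT})
    (B : {ffun 'I_k -> {group gT}}) :
  reflect ((forall i, B i \subset E) /\
           (forall i j : 'I_k, (i <= j)%N -> B i \subset B j))
          (B \in chains k E).
Proof.
rewrite inE; apply: (iffP andP) => [[/forallP h1 /forallP h2]|[h1 h2]].
  by split=> // i j ij; move: (h2 i) => /forallP/(_ j)/implyP; apply.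
split; apply/forallP=> // i; apply/forallP => j; apply/implyP; exact: h2.
Qed.

(** The weight makes the induction over subgroups of index p possible: [x i] counts the steps
    already made at which the i-th member was the first to leave the smaller subgroup, each of which
    costs a choice of coset. *)
Definition chain_weight (gT : finGroupType) (k : nat) (E : {group gT})
    (x : nat -> nat) :=
  (\sum_(B in chains k E) \prod_(i < k) #|E : B i| ^ x i)%N.

Definition incr (x : nat -> nat) (j : nat) := fun i => (x i + (i == j))%N.

(** The second elementary symmetric polynomial of the first [n] values of [x]. *)
Definition esym2 (x : nat -> nat) (n : nat) :=
  (\sum_(i < n) x i * \sum_(j < i) x j)%N.

Lemma esym2_incr (x : nat -> nat) (n j : nat) : (j < n)%N ->
  (esym2 x n + \sum_(i < j) x i <= esym2 (incr x j) n)%N.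
Proof.
move=> jn; rewrite /esym2 !(bigD1 (Ordinal jn) (P := xpredT)) //= addnAC.
apply: leq_add.
  rewrite -mulSnr /incr eqxx addn1 leq_mul //.
  by apply: leq_sum => i _; exact: leq_addr.
by apply: leq_sum => i _; rewrite leq_mul ?leq_addr // leq_sum // => l _; exact: leq_addr.
Qed.

Lemma esym2_sqr (x : nat -> nat) (n : nat) :
  ((esym2 x n).*2 + \sum_(i < n) x i ^ 2 = (\sum_(i < n) x i) ^ 2)%N.
Proof.
elim: n => [|n IH]; first by rewrite /esym2 !big_ord0.
rewrite /esym2 !big_ord_recr /= -/(esym2 x n) sqrnD -IH doubleD.
move: (esym2 x n) (x n) (\sum_(i < n) x i)%N (\sum_(i < n) x i ^ 2)%N => *.
by lia.
Qed.

Lemma sqr_sum_le (x : nat -> nat) (n : nat) :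
  ((\sum_(i < n) x i) ^ 2 <= n * \sum_(i < n) x i ^ 2)%N.
Proof.
elim: n => [|n IH]; first by rewrite !big_ord0.
rewrite !big_ord_recr /= sqrnD.
have H : (2 * ((\sum_(i < n) x i) * x n) <= \sum_(i < n) x i ^ 2 + n * x n ^ 2)%N.
  have -> : (n * x n ^ 2 = \sum_(i < n) x n ^ 2)%N by rewrite sum_nat_const card_ord.
  rewrite -big_split /= big_distrl /= big_distrr /=.
  by apply: leq_sum => i _; exact: nat_Cauchy.
move: H IH; move: (x n) (\sum_(i < n) x i)%N (\sum_(i < n) x i ^ 2)%N => *.
by nia.
Qed.

(** With s the sum of the k+1 entries, 2 e_2 = s^2 - sum x_i^2, and Cauchy-Schwarz gives sum x_i^2
    >= s^2 / (k+1). This is the source of the constant k / (2(k+1)). *)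
Lemma esym2_le (x : nat -> nat) (k : nat) :
  (esym2 x k.+1 <= (k * (\sum_(i < k.+1) x i) ^ 2) %/ (k.+1).*2)%N.
Proof.
rewrite leq_divRL ?double_gt0 //.
have := esym2_sqr x k.+1; have := sqr_sum_le x k.+1.
move: (esym2 x k.+1) (\sum_(i < k.+1) x i)%N (\sum_(i < k.+1) x i ^ 2)%N => *.
by nia.
Qed.

Section IndexPrime.
Variables (gT : finGroupType) (k p : nat) (E E' : {group gT}).
Hypotheses (p_pr : prime p) (nE : E' <| E) (iE : #|E : E'| = p).

Let sE : E' \subset E := normal_sub nE.

Definition capc (B : {ffun 'I_k -> {group gT}}) : {ffun 'I_k -> {group gT}} :=
  [ffun i => (B i :&: E')%G].

Lemma capc_chain B : B \in chains k E -> capc B \in chains k E'.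
Proof.
move=> /chainsP[h1 h2]; apply/chainsP; split=> [i|i j ij]; rewrite !ffunE /=.
  exact: subsetIr.
exact: setSI (h2 _ _ ij).
Qed.

Lemma mul_index_prime (B : {group gT}) :
  B \subset E -> ~~ (B \subset E') -> B * E' = E.
Proof.
move=> BE nB; have nBE' : B \subset 'N(E') by exact: subset_trans BE (normal_norm nE).
rewrite -norm_joinEl //; set J := B <*> E'.
have JE : J \subset E by rewrite join_subG BE.
have E'J : E' \subset J by exact: joing_subr.
have iJ : (#|E : J| * #|J : E'| = p)%N by rewrite -iE Lagrange_index.
have dJ : (#|J : E'| %| p)%N by rewrite -iJ dvdn_mull.
have /primeP[_ /(_ _ dJ)/orP[|] /eqP h] := p_pr.
  move: nB; rewrite (subset_trans _ (_ : J \subset E')) ?joing_subl //.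
  by rewrite -indexg_eq1 h.
apply/eqP; rewrite eqEsubset JE -indexg_eq1.
have pgt0 := prime_gt0 p_pr; have h' : #|J : E'| = p by rewrite h.
by apply/eqP; move: iJ; rewrite h'; move: #|E : J| => u; nia.
Qed.

Lemma index_cap_sub (B : {group gT}) :
  B \subset E' -> #|E : B| = (#|E' : B :&: E'| * p)%N.
Proof. by move=> BE'; rewrite (setIidPl BE') -iE mulnC Lagrange_index. Qed.

Lemma index_cap_nsub (B : {group gT}) :
  B \subset E -> ~~ (B \subset E') -> #|E : B| = #|E' : B :&: E'|.
Proof.
move=> BE nB; have := mul_cardG B E'; rewrite mul_index_prime //.
rewrite -(Lagrange BE) -(Lagrange (subsetIr B E')) /= => h.
have Bgt := cardG_gt0 B; have Igt := cardG_gt0 (B :&: E').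
by apply/eqP; rewrite -(eqn_pmul2l Bgt) -(eqn_pmul2l Igt); rewrite [X in X == _]mulnC -h mulnCA.
Qed.

(** The value [k] of [j] stands for a chain that stays inside [E']. *)
Definition jumps_at (j : nat) (B : {ffun 'I_k -> {group gT}}) :=
  [forall i : 'I_k, (B i \subset E') == (i < j)%N].

Lemma jump_exists B : B \in chains k E -> exists j : 'I_k.+1, jumps_at j B.
Proof.
move=> /chainsP[h1 h2].
case: (pickP (fun i => ~~ (B i \subset E'))) => [i0 ni0|h]; last first.
  exists ord_max; apply/forallP => i; rewrite ltn_ord.
  by move: (h i); case: (B i \subset E').
case: (@arg_minnP _ i0 (fun i => ~~ (B i \subset E')) (fun i => nat_of_ord i) ni0).
move=> i ni imin; exists (widen_ord (leqnSn k) i); apply/forallP => l /=.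
rewrite ltnNge; apply/eqP; apply/idP/idP => [Bl|].
  by apply: contra ni => il; apply: subset_trans (h2 _ _ il) Bl.
by apply: contraR => nl; exact: imin.
Qed.

(* A chain of E jumping out of E' at j is determined by its trace on E' and by
   one coset, modulo the j-th member of the trace. *)
Lemma jump_fiber (j : 'I_k.+1) (W : {ffun 'I_k -> {group gT}}) :
  (#|[set B in chains k E | jumps_at j B && (capc B == W)]| <=
     if insub (val j) is Some i then #|E' : W i| else 1)%N.
Proof.
case: insubP => [i _ /= ij|]; last first.
  rewrite -leqNgt => kj; apply: (@leq_trans #|[set W]|); last by rewrite cards1.
  apply: subset_leq_card; apply/subsetP => B; rewrite !inE => /and3P[_ /forallP jB /eqP <-].
  apply/eqP/ffunP => i; rewrite ffunE; apply/val_inj => /=; apply/esym/setIidPl.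
  by rewrite (eqP (jB i)) (leq_trans (ltn_ord i)).
case: (set_0Vmem (E :\: E')) => [|[g]].
  move=> h; have := prime_gt1 p_pr; rewrite -iE.
  by move/eqP: h; rewrite setD_eq0 -indexg_eq1 => /eqP ->.
rewrite inE => /andP[ngE' gE].
(* The part of [B i] in the coset [E' :* g] is a coset of the trace of [B i]; translated by [g^-1]
   it lies in [E'], which has [#|E' : W i|] cosets of [W i]. *)
pose cs (B : {ffun 'I_k -> {group gT}}) : {set gT} := (B i :&: E' :* g) :* g^-1.
have csP B : B \in chains k E -> jumps_at j B ->
    forall x, x \in B i -> x \in E' :* g -> cs B = (B i :&: E') :* (x * g^-1).
  move=> Bch jB x xB xg; rewrite /cs rcosetM; congr (_ :* _).
  have xgE : x * g^-1 \in E' by rewrite -mem_rcoset.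
  apply/setP => y; rewrite mem_rcoset !inE mem_rcoset; congr (_ && _).
    by rewrite groupMr // groupV.
  have -> : y * x^-1 = (y * g^-1) * (x * g^-1)^-1 by rewrite invMg invgK !mulgA mulgKV.
  by rewrite [RHS]groupMr // groupV.
have exx B : B \in chains k E -> jumps_at j B -> exists2 x, x \in B i & x \in E' :* g.
  move=> /chainsP[h1 _] /forallP/(_ i)/eqP; rewrite ij ltnn => /negbT nB.
  have := mul_index_prime (h1 i) nB => BE'.
  have : g^-1 \in B i * E' by rewrite BE' groupV.
  case/mulsgP => b e bB eE' ge; exists b^-1; first by rewrite groupV.
  by rewrite mem_rcoset ge mulKg.
have inj : {in [set B in chains k E | jumps_at j B && (capc B == W)] &, injective cs}.
  have key B1 B2 : B1 \in chains k E -> jumps_at j B1 -> capc B1 = W ->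
     B2 \in chains k E -> jumps_at j B2 -> capc B2 = W -> cs B1 = cs B2 ->
     forall l, B1 l \subset B2 l.
    move=> c1 j1 w1 c2 j2 w2 e l.
    have Wl : B1 l :&: E' = B2 l :&: E'.
      by have /ffunP/(_ l)/(congr1 val) := etrans w1 (esym w2); rewrite !ffunE.
    case: (boolP (B1 l \subset E')) => [s1|ns1].
      by rewrite -(setIidPl s1) Wl subsetIl.
    have jl : (i <= l)%N.
      by rewrite leqNgt ij; move/forallP: j1 => /(_ l) /eqP <-.
    have [x1 x1B x1g] := exx _ c1 j1.
    have x1B2 : x1 \in B2 i.
      have : x1 * g^-1 \in cs B1 by rewrite (csP _ c1 j1 _ x1B x1g) rcoset_refl.
      by rewrite e /cs mem_rcoset invgK mulgKV inE => /andP[].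
    have x1B2l : x1 \in B2 l by have /chainsP[_ h] := c2; exact: (subsetP (h _ _ jl)).
    have x1B1l : x1 \in B1 l by have /chainsP[_ h] := c1; exact: (subsetP (h _ _ jl)).
    have x1E : x1 \in E by have /chainsP[h _] := c1; exact: (subsetP (h i)).
    have nx1 : x1 \notin E'.
      apply: contra ngE' => x1E'; move: x1g; rewrite mem_rcoset groupMl //.
      by rewrite groupV.
    (* Since <x1> E' = E, each later member [B l] is generated by [x1] and its trace on [E'], data
       shared by the two chains. *)
    have cE : <[x1]> * E' = E.
      by apply: mul_index_prime; rewrite cycle_subG.
    apply/subsetP => y yB.
    have yE : y \in E by have /chainsP[h _] := c1; exact: (subsetP (h l)).
    move: yE; rewrite -cE => /mulsgP[u v uc vE' yuv].
    have u1 : u \in B1 l by move: uc; apply/subsetP; rewrite cycle_subG.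
    have u2 : u \in B2 l by move: uc; apply/subsetP; rewrite cycle_subG.
    have : v \in B1 l :&: E'.
      by rewrite inE vE' andbT -(groupMl _ u1) -yuv.
    by rewrite Wl inE yuv => /andP[? _]; rewrite groupM.
  move=> B1 B2; rewrite in_set => /and3P[c1 j1 /eqP w1].
  rewrite in_set => /and3P[c2 j2 /eqP w2] e.
  apply/ffunP => l; apply/val_inj/eqP; rewrite eqEsubset /=; apply/andP.
  by split; apply: key.
rewrite -(card_in_imset inj); apply: subset_leq_card.
apply/subsetP => _ /imsetP[B + ->]; rewrite in_set => /and3P[c1 j1 /eqP w1].
have [x1 x1B x1g] := exx _ c1 j1.
rewrite (csP _ c1 j1 _ x1B x1g) -w1 ffunE /=; apply/rcosetsP.
by exists (x1 * g^-1) => //; rewrite -mem_rcoset.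
Qed.

(** For a chain that jumps at j, replacing [E] by [E'] divides the index by p at the positions i < j
    and keeps it at the others. At most #|E' : W j| chains share the trace W when j < k, which
    raises the exponent at j by one; when j = k the trace is the chain itself. *)
Lemma chain_weight_step (x : nat -> nat) :
  (chain_weight k E x <=
     \sum_(j < k.+1) p ^ (\sum_(i < j) x i) * chain_weight k E' (incr x j))%N.
Proof.
pose F B := (\prod_(i < k) #|E : (B : {ffun 'I_k -> {group gT}}) i| ^ x i)%N.
rewrite /chain_weight.
apply: (@leq_trans (\sum_(j < k.+1) \sum_(B in chains k E | jumps_at j B) F B)).
  rewrite (exchange_big_dep (fun B => B \in chains k E)) /=; last by move=> ? ? _ /andP[].
  apply: leq_sum => B cB; have [j jB] := jump_exists cB.
  by rewrite (bigD1 j) /=; [exact: leq_addr | rewrite cB].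
apply: leq_sum => j _.
rewrite (partition_big capc (fun W => W \in chains k E')) /=; last first.
  by move=> B /andP[cB _]; exact: capc_chain.
rewrite big_distrr /=; apply: leq_sum => W cW.
have FB B : (B \in chains k E) && jumps_at j B && (capc B == W) ->
    F B = (p ^ (\sum_(i < j) x i) * \prod_(i < k) #|E' : W i| ^ x i)%N.
  case/andP => /andP[cB /forallP jB] /eqP <-.
  have -> : (\sum_(i < j) x i = \sum_(i < k) (if (i < j)%N then x i else 0))%N.
    rewrite -big_mkcond (big_ord_narrow (F := fun i : 'I_k => x i)) //.
    by rewrite -ltnS.
  rewrite expn_sum -big_split; apply: eq_bigr => i _ /=.
  rewrite ffunE /=; move: (jB i); have /chainsP[/(_ i) Bi _] := cB.
  case: ltnP => _ /eqP Bi'; last by rewrite mul1n index_cap_nsub // Bi'.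
  by rewrite index_cap_sub // expnMn mulnC.
rewrite (eq_bigr _ FB) sum_nat_const mulnCA leq_mul2l; apply/orP; right.
have -> : (\prod_(i < k) #|E' : W i| ^ incr x j i =
   (if insub (val j) is Some i then #|E' : W i| else 1) * \prod_(i < k) #|E' : W i| ^ x i)%N.
  rewrite /incr; under eq_bigr do rewrite expnD; rewrite big_split /= mulnC; congr (_ * _)%N.
  case: insubP => [i _ ij|].
    rewrite (bigD1 i) //= ij eqxx expn1 big1 ?muln1 // => l li.
    by rewrite -ij; case: eqP => [/val_inj e|]; rewrite ?expn0 //; rewrite e eqxx in li.
  rewrite -leqNgt => kj; rewrite big1 // => l _.
  by case: eqP => // e; move: (ltn_ord l); rewrite e ltnNge kj.
rewrite leq_mul2r; apply/orP; right; apply: leq_trans (jump_fiber j W).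
apply: subset_leq_card; apply/subsetP => B.
by rewrite unfold_in => /andP[/andP[cB jB] wB]; rewrite in_set cB jB.
Qed.

End IndexPrime.

(** A maximal subgroup of the Sylow p-subgroup, times the p'-core. *)
Lemma abelian_index_prime (gT : finGroupType) (E : {group gT}) (p : nat) :
  prime p -> abelian E -> (p %| #|E|)%N ->
  exists2 E' : {group gT}, E' \subset E & #|E : E'| = p.
Proof.
move=> p_pr abE pE.
have nilE := abelian_nil abE.
have dE := nilpotent_pcoreC p nilE.
set P := 'O_p(E) in dE; set C := 'O_p^'(E) in dE.
have cardE : (#|P| * #|C| = #|E|)%N by rewrite (dprod_card dE).
have pP : p.-group P := pcore_pgroup p E.
have ntP : P :!=: 1.
  apply: contraL pE => /eqP P1; rewrite -cardE P1 cards1 mul1n -p'natE //.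
  exact: pcore_pgroup.
have [M maxM _] : {M : {group gT} | maximal M P & [1] \subset M}.
  by apply: maxgroup_exists; rewrite proper1G.
have iM := p_maximal_index pP maxM.
have MP := maxgroupp maxM; have sMP := proper_sub MP.
have PE : P \subset E := pcore_sub _ _.
have CE : C \subset E := pcore_sub _ _.
have tiPC : P :&: C = 1 by have [] := dprodP dE.
have tiMC : M :&: C = 1.
  by apply/trivgP; rewrite -tiPC setSI.
exists (M <*> C)%G.
  by rewrite join_subG CE (subset_trans sMP).
have nMC : M \subset 'N(C).
  by rewrite (subset_trans (subset_trans sMP PE)) // sub_abelian_norm.
have cMC : (#|M <*> C| = #|M| * #|C|)%N by rewrite norm_joinEl // TI_cardMg.
rewrite -divgS ?join_subG ?CE ?(subset_trans sMP) //= cMC -cardE.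
rewrite -(Lagrange sMP) iM.
have := cardG_gt0 M; have := cardG_gt0 C => c0 m0.
by rewrite mulnAC mulKn // muln_gt0 m0.
Qed.

(** A crude bound suffices here: it is applied once the factor p^m has been peeled off and the order
    is the fixed [c]. *)
Lemma card_chains_le (gT : finGroupType) (k : nat) (E : {group gT}) :
  (#|chains k E| <= (2 ^ #|E|) ^ k)%N.
Proof.
pose SE := [set H : {group gT} | H \subset E].
apply: (@leq_trans (#|SE| ^ k)).
  rewrite -[X in (_ ^ X)%N](card_ord k) -card_ffun_on; apply: subset_leq_card.
  apply/subsetP => B /chainsP[h _].
  by apply/ffun_onP => i; rewrite inE.
have sSE : (#|SE| <= 2 ^ #|E|)%N.
  rewrite -card_powerset -(card_imset _ (@val_inj _ _ (group_of gT))).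
  apply: subset_leq_card; apply/subsetP => _ /imsetP[H HE ->].
  by rewrite powersetE; rewrite inE in HE.
by case: (posnP k) => [->|k0]; rewrite ?expn0 // leq_exp2r.
Qed.

(** The factor [p ^ esym2 x k.+1] is a potential: by [esym2_incr] its growth absorbs the power of p
    released at each step, so that a step costs only the factor k+1 for the choice of j. When m
    reaches 0 the sum of [x] has grown by the initial m, and [esym2_le] bounds the potential. *)
Lemma chain_weight_le (k c p m : nat) (gT : finGroupType) (E : {group gT})
    (x : nat -> nat) :
  prime p -> abelian E -> #|E| = (c * p ^ m)%N ->
  (chain_weight k E x * p ^ esym2 x k.+1 <=
   k.+1 ^ m * (2 ^ c) ^ k * c ^ (\sum_(i < k.+1) x i + m) *
   p ^ ((k * (\sum_(i < k.+1) x i + m) ^ 2) %/ (k.+1).*2))%N.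
Proof.
move=> p_pr; elim: m => [|m IH] in E x *.
  rewrite expn0 muln1 mul1n addn0 => abE cE.
  apply: leq_mul; last by rewrite leq_exp2l ?prime_gt1 // esym2_le.
  apply: (@leq_trans (\sum_(B in chains k E) c ^ (\sum_(i < k.+1) x i))%N).
    apply: leq_sum => B /chainsP[h _]; rewrite big_ord_recr /= expnD.
    rewrite -[X in (X <= _)%N]muln1 leq_mul ?expn_gt0 -?cE ?cardG_gt0 //.
    rewrite expn_sum; apply: leq_prod => i _.
    case: (posnP (x i)) => [->|x0]; rewrite ?expn0 // leq_exp2r //.
    by rewrite -(Lagrange (h i)) leq_pmull.
  by rewrite sum_nat_const leq_mul2r -cE card_chains_le orbT.
move=> abE cE.
have pE : (p %| #|E|)%N by rewrite cE expnS mulnCA dvdn_mulr.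
have [E' sE iE] := abelian_index_prime p_pr abE pE.
have nE : E' <| E by rewrite -sub_abelian_normal.
have cE' : #|E'| = (c * p ^ m)%N.
  apply/eqP; rewrite -(eqn_pmul2r (prime_gt0 p_pr)) -{1}iE Lagrange // cE.
  by rewrite expnS mulnCA mulnC.
have abE' := abelianS sE abE.
apply: (@leq_trans (\sum_(j < k.+1) chain_weight k E' (incr x j) * p ^ esym2 (incr x j) k.+1)%N).
  apply: leq_trans (leq_mul (chain_weight_step k p_pr nE iE x) (leqnn _)) _.
  rewrite big_distrl /=; apply: leq_sum => j _.
  rewrite mulnAC -expnD mulnC leq_mul2l leq_exp2l ?prime_gt1 //.
  by rewrite addnC esym2_incr ?orbT.
have sincr (j : 'I_k.+1) : (\sum_(i < k.+1) incr x j i + m = \sum_(i < k.+1) x i + m.+1)%N.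
  rewrite /incr big_split /= -addnA; congr (_ + _)%N.
  rewrite (bigD1 j) //= eqxx big1 ?addn0 ?add1n // => i ij.
  by case: eqP => // /val_inj e; rewrite e eqxx in ij.
apply: (@leq_trans (\sum_(j < k.+1) k.+1 ^ m * (2 ^ c) ^ k * c ^ (\sum_(i < k.+1) x i + m.+1) *
   p ^ ((k * (\sum_(i < k.+1) x i + m.+1) ^ 2) %/ (k.+1).*2))%N).
  by apply: leq_sum => j _; rewrite -(sincr j); exact: IH.
by rewrite sum_nat_const card_ord (expnS k.+1) !mulnA.
Qed.

(** The induction starts from x = 0. The exponent of p is a multiple of 2(k+1), which makes the
    division in [chain_weight_le] exact. *)
Lemma card_chains_bound (k c p t : nat) (gT : finGroupType) (E : {group gT}) :
  prime p -> abelian E -> #|E| = (c * p ^ (t * (k.+1).*2))%N ->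
  (#|chains k E| <= (2 ^ c) ^ k * (k.+1 * c) ^ (t * (k.+1).*2) *
     p ^ (k * k.+1 * t ^ 2).*2)%N.
Proof.
move=> p_pr abE cE.
have := chain_weight_le k (fun=> 0%N) p_pr abE cE.
have -> : esym2 (fun=> 0%N) k.+1 = 0%N by rewrite /esym2 big1.
rewrite sum_nat_const muln0 muln1 add0n /chain_weight.
under eq_bigr do rewrite big1 //.
rewrite sum1_card => h; apply: leq_trans h _; apply/eq_leq.
rewrite (expnMn k.+1 c) (mulnA ((2 ^ c) ^ k)%N); congr (_ * _ * _)%N; first exact: mulnC.
congr (p ^ _)%N.
have -> : (k * (t * k.+1.*2) ^ 2 = (k * k.+1 * t ^ 2).*2 * k.+1.*2)%N by lia.
by rewrite mulnK // double_gt0.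
Qed.

End ChainCounting.

From mathcomp Require Import finmap ring_quotient freeg.
From mathcomp Require Import all_classical all_reals all_analysis.
From mathcomp Require Import measurable_realfun.

Import numFieldNormedType.Exports.

(** * Homomorphisms between finite abelian groups *)

(* The pointwise zmodType structures on products, powers and subsets of finite
   groups have to be joined by hand with their finType structures. *)
Definition prod_type (G V : finZmodType) : Type := (G * V)%type.
HB.instance Definition _ (G V : finZmodType) := Finite.on (prod_type G V).
HB.instance Definition _ (G V : finZmodType) := GRing.Zmodule.on (prod_type G V).
Definition prodZ (G V : finZmodType) : finZmodType := prod_type G V.

Definition ffun_type (H : finType) (G : finZmodType) : Type := {ffun H -> G}.
HB.instance Definition _ (H : finType) (G : finZmodType) := Finite.on (ffun_type H G).
HB.instance Definition _ (H : finType) (G : finZmodType) := GRing.Zmodule.on (ffun_type H G).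
Definition ffunZ (H : finType) (G : finZmodType) : finZmodType := ffun_type H G.

Section FiniteHoms.
Local Open Scope ring_scope.

Definition homs (H G : finZmodType) : {set {ffun H -> G}} :=
  [set f : {ffun H -> G} | [forall x, forall y, f (x - y) == f x - f y]].

Definition surs (H G : finZmodType) : {set {ffun H -> G}} :=
  [set f in homs H G | f @: [set: H]%SET == [set: G]%SET].

Lemma homsP (H G : finZmodType) (f : {ffun H -> G}) :
  reflect (GRing.zmod_morphism f) (f \in homs H G).
Proof.
rewrite inE; apply: (iffP forallP) => [h x y|h x].
  by have /forallP/(_ y)/eqP := h x.
by apply/forallP => y; rewrite h.
Qed.

Lemma sursP (H G : finZmodType) (f : {ffun H -> G}) :
  reflect (GRing.zmod_morphism f /\ forall y, exists x, y = f x) (f \in surs H G).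
Proof.
rewrite finset.in_set; apply: (iffP andP) => -[/homsP h1 h2]; split => //.
- move=> y; have : y \in f @: [set: H]%SET by rewrite (eqP h2) finset.in_setT.
  by case/imsetP => x _ ->; exists x.
- rewrite finset.eqEsubset finset.subsetT; apply/fintype.subsetP => y _.
  by have [x ->] := h2 y; rewrite imset_f.
Qed.

(** Applied to the identity, it turns [nSur] into the cardinal of a finite set; applied to the
    projection of a group onto its tensor product with Z/a, it reduces surjections from an infinite
    group to a finite one. *)
Lemma zmod_morphism_Sur_card (X : zmodType) (H G : finZmodType) (q : X -> H) :
  GRing.zmod_morphism q -> (forall y, exists x, y = q x) ->
  (forall f : X -> G, GRing.zmod_morphism f -> exists g : H -> G, f = g \o q) ->
  nSur X G = #|surs H G|.
Proof.
move=> qM qS qF; apply: card_fset_set.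
pose e (i : 'I_#|surs H G|) : X -> G := enum_val i \o q.
have -> : Sur X G = (e @` [set: 'I_#|surs H G|])%classic.
  apply/seteqP; split=> f /=.
    move=> [fM fS]; have [g fg] := qF f fM.
    have gs : [ffun x => g x] \in surs H G.
      apply/sursP; split=> [y y'|z].
        have [x ->] := qS y; have [x' ->] := qS y'; rewrite -qM !ffunE.
        by move: (fM x x'); rewrite fg.
      have [x _ <-] := fS z I; exists (q x).
      by rewrite ffunE fg.
    exists (enum_rank_in gs [ffun x => g x]) => //.
    by rewrite /e enum_rankK_in // fg; apply/funext => x /=; rewrite ffunE.
  move=> [i _ <-]; have /sursP[h1 h2] := enum_valP i; split=> [x y|z _].
    by rewrite /e /= qM h1.
  by have [y ->] := h2 z; have [x ->] := qS y; exists x.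
apply: (card_eq_trans (inj_card_eq _)); last by rewrite card_eq_sym card_II.
move=> i j _ _ ij; apply: enum_val_inj; apply/ffunP => y.
by have [x ->] := qS y; rewrite -[LHS]/(e i x) ij.
Qed.

Lemma nSur_surs (H G : finZmodType) : nSur H G = #|surs H G|.
Proof.
apply: (@zmod_morphism_Sur_card H H G id) => [//|y|f _]; first by exists y.
by exists f.
Qed.

Definition nHom (H G : finZmodType) : nat := #|homs H G|.

Lemma nSur_le_nHom (H G : finZmodType) : (nSur H G <= nHom H G)%N.
Proof.
rewrite nSur_surs; apply/subset_leq_card/fintype.subsetP => f.
by rewrite finset.in_set => /andP[].
Qed.

Lemma nSur_self_gt0 (H : finZmodType) : (0 < nSur H H)%N.
Proof.
rewrite nSur_surs card_gt0; apply/set0Pn; exists [ffun x => x]; apply/sursP.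
by split=> [x y|y]; [rewrite !ffunE | exists y; rewrite ffunE].
Qed.

Lemma nSur_gt0_leq (H G : finZmodType) : (0 < nSur H G)%N -> (#|G| <= #|H|)%N.
Proof.
rewrite nSur_surs card_gt0 => /set0Pn[f]; rewrite finset.in_set => /andP[_ /eqP fT].
by rewrite -cardsT -fT (leq_trans (leq_imset_card _ _)) // cardsT.
Qed.

Lemma nSur_gt0_iso (H G : finZmodType) :
  (0 < nSur H G)%N -> #|H| = #|G| -> zmod_iso H G.
Proof.
rewrite nSur_surs card_gt0 => /set0Pn[f] fs HG.
have /sursP[fM _] := fs; move: fs; rewrite finset.in_set => /andP[_ /eqP fT].
exists f => //; apply: inj_card_bij; last by rewrite HG.
apply/injectiveP; rewrite /injectiveb /dinjectiveb.
have : #|f @: [set: H]%SET| == #|[set: H]%SET| by rewrite fT !cardsT HG.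
move/imset_injP => inj; apply/injectiveP => x y; apply: inj; exact: finset.in_setT.
Qed.

Lemma nHom_prod (H G V : finZmodType) : nHom H (prodZ G V) = (nHom H G * nHom H V)%N.
Proof.
rewrite /nHom -cardsX.
pose F (f : {ffun H -> prodZ G V}) : {ffun H -> G} * {ffun H -> V} :=
  ([ffun x => (f x).1], [ffun x => (f x).2]).
have Finj : injective F.
  move=> f g [/ffunP e1 /ffunP e2]; apply/ffunP => x.
  by move: (e1 x) (e2 x); rewrite !ffunE; case: (f x) (g x) => ? ? [? ?] /= -> ->.
rewrite -(card_imset _ Finj); apply/eq_card => -[u v].
rewrite finset.in_setX /=; apply/imsetP/andP => [[f /homsP fM [-> ->]]|[/homsP uM /homsP vM]].
  by split; apply/homsP => x y; rewrite !ffunE fM.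
exists [ffun x => (u x, v x)].
  by apply/homsP => x y; rewrite !ffunE uM vM.
by congr pair; apply/ffunP => x; rewrite !ffunE.
Qed.

Lemma card_Zmod (p : nat) : (0 < p)%N -> #|Zmod p| = p.
Proof. by rewrite card_ord => /prednK. Qed.

(** The homomorphisms form a subgroup of the p-group of all functions from [H] to [Zmod p]. *)
Lemma nHom_prime (H : finZmodType) (p : nat) : prime p ->
  exists s, nHom H (Zmod p) = (p ^ s)%N.
Proof.
move=> p_pr.
have gsh : group_set (homs H (Zmod p) : {set ffunZ H (Zmod p)}).
  apply/group_setP; split=> [|f g /homsP fM /homsP gM]; apply/homsP => x y.
    by rewrite !ffunE subrr.
  by rewrite !ffunE fM gM opprD addrACA.
have : (nHom H (Zmod p) %| p ^ #|H|)%N.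
  have := cardSg (finset.subsetT (Group gsh)).
  by rewrite cardsT card_ffun card_Zmod ?prime_gt0.
by move=> /(dvdn_pfactor _ _ p_pr)[s _ ->]; exists s.
Qed.

End FiniteHoms.

(** * Subgroups as groups, and homomorphisms sorted by their images *)

Section Subgroups.
Local Open Scope ring_scope.
Variables (G : finZmodType) (B : {group G}).

Definition in_subgroup : {pred G} := fun x => x \in B.

Lemma in_subgroup_closed : GRing.zmod_closed in_subgroup.
Proof.
split=> [|x y xB yB]; first exact: (group1 B).
exact: (groupM xB (groupVr yB)).
Qed.

HB.instance Definition _ :=
  GRing.isZmodClosed.Build G in_subgroup in_subgroup_closed.

Definition sub_type := {x : G | in_subgroup x}.

HB.instance Definition _ := SubChoice.on sub_type.
HB.instance Definition _ := [Finite of sub_type by <:].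
HB.instance Definition _ := [SubChoice_isSubZmodule of sub_type by <:].

Definition subZ : finZmodType := sub_type.

End Subgroups.

Section SubgroupCounts.
Local Open Scope ring_scope.

Lemma card_subZ (G : finZmodType) (B : {group G}) : #|subZ B| = #|B|.
Proof. by rewrite card_sig; apply: eq_card. Qed.

Lemma exponent_dvdP (a : nat) (G : finZmodType) :
  exponent_dvd a G <-> forall x : G, x *+ a = 0.
Proof.
rewrite /exponent_dvd; split=> [h x|h].
  by apply: (exponentP h); rewrite finset.in_setT.
by apply/exponentP => x _; exact: h.
Qed.

Lemma exponent_dvd_subZ (a : nat) (G : finZmodType) (B : {group G}) :
  exponent_dvd a G -> exponent_dvd a (subZ B).
Proof.
move=> /exponent_dvdP h; apply/exponent_dvdP => x.
by apply: val_inj; rewrite raddfMn h raddf0.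
Qed.

Lemma exponent_dvd_prod (a : nat) (G V : finZmodType) :
  exponent_dvd a G -> exponent_dvd a V -> exponent_dvd a (prodZ G V).
Proof.
move=> /exponent_dvdP h /exponent_dvdP h'; apply/exponent_dvdP => -[x y].
by rewrite pairMnE /= h h'.
Qed.

Lemma exponent_dvd_Zmod (a p : nat) : (0 < p)%N -> (p %| a)%N -> exponent_dvd a (Zmod p).
Proof.
move=> p0 pa; apply: dvdn_trans (exponent_dvdn _) _.
by rewrite cardsT card_Zmod.
Qed.

Lemma nHom_sum_nSur (H G : finZmodType) :
  nHom H G = (\sum_(B : {group G}) nSur H (subZ B))%N.
Proof.
rewrite /nHom -sum1_card.
have img (f : {ffun H -> G}) : f \in homs H G -> group_set (f @: [set: H]%SET).
  move=> /homsP fM.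
  have f0 : f 0 = 0 by rewrite -(subrr 0) fM subrr.
  have fD x y : f (x + y) = f x + f y.
    by rewrite -{1}[y]opprK fM -[- y]add0r fM f0 sub0r opprK.
  apply/group_setP; split; first by apply/imsetP; exists 0.
  move=> _ _ /imsetP[x _ ->] /imsetP[y _ ->]; by apply/imsetP; exists (x + y).
(* [generated_group] makes [im] total; the image of a homomorphism is already a subgroup, so
   generation does not change it. *)
pose im (f : {ffun H -> G}) : {group G} := generated_group (f @: [set: H]%SET).
rewrite (partition_big im xpredT) //=; apply: eq_bigr => B _.
rewrite sum1dep_card nSur_surs.
pose F (g : {ffun H -> subZ B}) : {ffun H -> G} := [ffun x => val (g x)].
have Finj : injective F.
  by move=> g g' /ffunP e; apply/ffunP => x; apply: val_inj; move: (e x); rewrite !ffunE.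
rewrite -(card_imset _ Finj); apply/eq_card => f; rewrite finset.in_set.
apply/andP/imsetP => [[fh /eqP fB]|[g /sursP[gM gS] ->]].
  have fB' : f @: [set: H]%SET = B.
    by rewrite -fB /im /= (gen_set_id (img f fh)).
  have fxB x : in_subgroup B (f x) by rewrite /in_subgroup -fB' imset_f.
  have /homsP fM := fh.
  exists [ffun x => exist _ (f x) (fxB x) : subZ B]; last by apply/ffunP => x; rewrite !ffunE.
  apply/sursP; split=> [x y|[y yB]].
    by apply: val_inj; rewrite !ffunE /= fM.
  have : y \in f @: [set: H]%SET by rewrite fB'.
  case/imsetP => x _ yx; exists x; apply: val_inj; by rewrite !ffunE /=.
have Fh : F g \in homs H G.
  by apply/homsP => x y; rewrite !ffunE gM raddfB.
split=> //; apply/eqP/val_inj; rewrite /im /= (gen_set_id (img _ Fh)).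
apply/setP => y; apply/imsetP/idP => [[x _ ->]|yB].
  by rewrite ffunE; exact: (valP (g x)).
have [x ex] := gS (exist _ y yB); exists x => //.
by rewrite ffunE -ex.
Qed.

(** Dropping H_0 = 0 from a chain 0 = H_0 <= ... <= H_k = B leaves k nested subgroups of [G] whose
    last member is [B], and [B] is recovered from it. *)
Lemma sum_n_chains_le (k : nat) (G : finZmodType) : (0 < k)%N ->
  (\sum_(B : {group G}) n_chains k (subZ B) <= #|chains k [set: G]%SET|)%N.
Proof.
case: k => // k _.
rewrite -sum1_card (partition_big (fun c : {ffun 'I_k.+1 -> {group G}} => c ord_max) xpredT) //=.
apply: leq_sum => B _; rewrite sum1dep_card /n_chains.
have vg (K : {group subZ B}) : group_set ((val : subZ B -> G) @: K).
  apply/group_setP; split; first by apply/imsetP; exists 0 => //; exact: (group1 K).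
  move=> _ _ /imsetP[x xK ->] /imsetP[y yK ->]; apply/imsetP; exists (x + y) => //.
  exact: (groupM xK yK).
pose F (c : {ffun 'I_k.+2 -> {group subZ B}}) : {ffun 'I_k.+1 -> {group G}} :=
  [ffun i => Group (vg (c (fintype.lift ord0 i)))].
set A := (X in (#|X| <= _)%N).
have Finj : {in A &, injective F}.
  move=> c d; rewrite /A !finset.in_set => /and3P[/eqP c0 _ _] /and3P[/eqP d0 _ _] /ffunP e.
  apply/ffunP => i; case: (unliftP ord0 i) => [j ->|->]; last by rewrite c0 d0.
  move: (e j); rewrite !ffunE => /(congr1 val) /= e'; apply/val_inj/setP => x.
  by rewrite -!(mem_imset _ _ (@val_inj _ _ (subZ B))) e'.
rewrite -(card_in_imset Finj); apply/subset_leq_card/fintype.subsetP => _ /imsetP[c + ->].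
rewrite /A finset.in_set => /and3P[/eqP c0 /eqP cm /forallP cS].
have cmono (n m : nat) (hn : (n < k.+2)%N) (hm : (m < k.+2)%N) : (n <= m)%N ->
    c (Ordinal hn) \subset c (Ordinal hm).
  elim: m => [|m IH] in hn hm *.
    by rewrite leqn0 => /eqP n0; move: hn; rewrite n0 => hn; rewrite (bool_irrelevance hn hm).
  rewrite leq_eqVlt => /orP[/eqP e|nm].
    by move: hn; rewrite e => hn; rewrite (bool_irrelevance hn hm).
  have hm' : (m < k.+1)%N by [].
  apply: fintype.subset_trans (IH hn (ltnW hm) nm) _.
  have := cS (Ordinal hm').
  have -> : widen_ord (leqnSn k.+1) (Ordinal hm') = Ordinal (ltnW hm) by apply: val_inj.
  by have -> : fintype.lift ord0 (Ordinal hm') = Ordinal hm by apply: val_inj.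
rewrite finset.in_set; apply/andP; split.
  apply/chainsP; split=> [i|i j ij]; first exact: finset.subsetT.
  rewrite !ffunE /=; apply: imsetS.
  have {1}-> : fintype.lift ord0 i = Ordinal (ltn_ord (fintype.lift ord0 i)) by apply: val_inj.
  have -> : fintype.lift ord0 j = Ordinal (ltn_ord (fintype.lift ord0 j)) by apply: val_inj.
  by apply: cmono.
apply/eqP/val_inj; rewrite ffunE /=.
have -> : fintype.lift ord0 (ord_max : 'I_k.+1) = ord_max by apply: val_inj.
rewrite cm; apply/setP => y; apply/imsetP/idP => [[x _ ->]|yB]; first exact: (valP x).
by exists (exist _ y yB : subZ B); rewrite // finset.in_setT.
Qed.

Lemma zmod_abelian (G : finZmodType) (B : {group G}) : abelian B.
Proof. by apply/centsP => x _ y _; exact: addrC. Qed.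

End SubgroupCounts.

(** * Finiteness of the groups with few homomorphisms to Z/p *)

Section Boundedness.
Local Open Scope ring_scope.

Definition powZ (p m : nat) (G : finZmodType) : finZmodType :=
  iter m (prodZ (Zmod p)) G.

Lemma nHom_powZ (H G : finZmodType) (p m : nat) :
  nHom H (powZ p m G) = (nHom H (Zmod p) ^ m * nHom H G)%N.
Proof.
by elim: m => [|m IH]; rewrite ?mul1n //= nHom_prod IH expnS mulnA.
Qed.

Lemma card_powZ (G : finZmodType) (p m : nat) : (0 < p)%N ->
  #|powZ p m G| = (#|G| * p ^ m)%N.
Proof.
move=> p0; elim: m => [|m IH]; first by rewrite muln1.
by rewrite /= card_prod card_Zmod // IH expnS mulnCA.
Qed.

Lemma exponent_dvd_powZ (a p m : nat) (G : finZmodType) : (0 < p)%N -> (p %| a)%N ->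
  exponent_dvd a G -> exponent_dvd a (powZ p m G).
Proof.
by move=> p0 pa aG; elim: m => //= m IH; apply: exponent_dvd_prod => //; exact: exponent_dvd_Zmod.
Qed.

(** The quotient H/B is a nontrivial abelian group, so for a prime q dividing its order it has a
    subgroup of index q, with quotient cyclic of order q. *)
Lemma prime_quotient_hom (H : finZmodType) (B : {group H}) :
  B \proper [set: H]%SET ->
  exists q : nat, [/\ prime q, (q %| #|H|)%N &
    exists f : {ffun H -> Zmod q}, [/\ f \in homs H (Zmod q),
      forall x, x \in B -> f x = 0 & exists x, f x != 0]].
Proof.
move=> pB; set E := [set: H]%G.
have nB (A : {set H}) : A \subset 'N(B)%g.
  apply: fintype.subset_trans (finset.subsetT _) _.
  by apply: sub_abelian_norm => //; exact: (zmod_abelian E).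
set Q := (E / B)%G.
have Q1 : (1 < #|Q|)%N.
  rewrite cardG_gt1; apply/negP => /eqP /trivgP; rewrite quotient_sub1 // => EB.
  by move: pB; rewrite properE EB andbF.
have qP := pdiv_prime Q1; set q := pdiv #|Q| in qP.
have abQ : abelian Q by apply: quotient_abelian; exact: (zmod_abelian E).
have [E' sE' iE'] := abelian_index_prime qP abQ (pdiv_dvd _).
have nE' : (Q \subset 'N(E'))%g by apply: sub_abelian_norm.
have cR : #|(Q / E')%G| = q by rewrite /= card_quotient.
have cycR : cyclic (Q / E') by apply: prime_cyclic; rewrite cR.
have cZ : #|[set: Zmod q]%G| = q by rewrite cardsT card_Zmod ?prime_gt0.
have : (Q / E') \isog [set: Zmod q]%G.
  by rewrite isog_cyclic_card // cZ cR eqxx andbT prime_cyclic // cZ.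
case/isogP => g injg gQ.
have inQ (x : H) : coset B x \in Q by apply: mem_quotient; rewrite finset.in_setT.
have inR (x : H) : coset E' (coset B x) \in (Q / E')%G by apply: mem_quotient; exact: inQ.
pose f : {ffun H -> Zmod q} := [ffun x => g (coset E' (coset B x))].
have fD x y : f (x + y) = f x + f y.
  rewrite !ffunE -[x + y]/(x * y)%g.
  have nx (z : H) : z \in 'N(B)%g by apply: (fintype.subsetP (nB E)); rewrite finset.in_setT.
  rewrite (morphM (coset_morphism B)) ?nx //.
  rewrite (morphM (coset_morphism E')) ?(fintype.subsetP nE') ?inQ //.
  by rewrite morphM ?inR.
exists q; split => //.
  rewrite -cardsT; apply: dvdn_trans (pdiv_dvd _) _; exact: dvdn_quotient.
exists f; split.
- apply/homsP => x y.
  have f0 : f 0 = 0 by apply: (addrI (f 0)); rewrite -fD !addr0.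
  by apply: (addIr (f y)); rewrite -fD !subrK.
- move=> x xB; rewrite ffunE; have xB1 : coset B x = 1%g by exact: coset_id.
  have x1 : coset E' (coset B x) = 1%g.
    exact: etrans (congr1 (coset E') xB1) (morph1 (coset_morphism E')).
  exact: etrans (congr1 g x1) (morph1 g).
- have : exists2 r, r \in (Q / E')%G & r != 1%g.
    apply/trivgPn; rewrite -cardG_gt1 cR; exact: prime_gt1.
  case=> r /morphimP[y _ yQ rE] r1.
  have /morphimP[x _ _ yE] := yQ; exists x.
  apply: contra r1 => /eqP fx; rewrite rE yE; apply/eqP.
  apply: (injmP injg); [exact: inR|exact: group1|].
  by move: fx; rewrite ffunE => ->; rewrite (morph1 g).
Qed.

Lemma card_gen_le (gT : finGroupType) (a : nat) (s : seq gT) :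
  abelian [set: gT]%SET -> (forall x : gT, #[x]%g <= a)%N ->
  (#|<<[set:: s]>>%G| <= a ^ size s)%N.
Proof.
move=> ab oa; elim: s => [|x s IH].
  by rewrite finset.set_nil /= gen0 cards1.
have -> : <<[set:: x :: s]>>%G = (<[x]> <*> <<[set:: s]>>)%G.
  apply/val_inj; rewrite /= joing_idr joing_idl.
  by rewrite finset.set_cons.
have nn : (<[x]> \subset 'N(<<[set:: s]>>))%g.
  by apply: fintype.subset_trans (finset.subsetT _) _; apply: sub_abelian_norm.
rewrite /= norm_joinEl // expnS.
apply: leq_trans (leq_mul (oa x) IH).
have := mul_cardG <[x]>%G <<[set:: s]>>%G; rewrite /= -orderE => ->.
by rewrite leq_pmulr // cardG_gt0.
Qed.

(* Homs to Zmod p for p | a separate the cosets of the Frattini subgroup, and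
   representatives of these cosets generate H. *)
Lemma card_le_of_nHom (a r : nat) (H : finZmodType) : (0 < a)%N ->
  exponent_dvd a H ->
  (forall p, p \in primes a -> (nHom H (Zmod p) <= r)%N) ->
  (#|H| <= a ^ (a.+1 ^ (a.+1 * r)))%N.
Proof.
move=> a0 /exponent_dvdP aH hr.
pose V : finType := {ffun 'I_a.+1 * 'I_r -> 'I_a.+1}.
(* The profile of [x]: the values at [x] of the first [r] homomorphisms to each [Zmod p] with p <=
   a, padded by the zero function. For p in [primes a] these are all the homomorphisms. *)
pose th (x : H) : V := [ffun pj : 'I_a.+1 * 'I_r =>
    inord (nth [ffun=> 0] (enum (homs H (Zmod pj.1))) pj.2 x)].
(* One element for each profile that occurs, so the length is at most the number (a+1)^((a+1) r) of
   possible profiles. *)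
pose s : seq H := pmap (fun v => [pick x | th x == v]) (enum V).
have ss : (size s <= a.+1 ^ (a.+1 * r))%N.
  rewrite size_pmap; apply: leq_trans (count_size _ _) _.
  by rewrite -cardE card_ffun card_prod !card_ord.
have sth x : exists2 y, y \in s & th y = th x.
  case: pickP (erefl [pick y | th y == th x]) => [y /eqP yx _|/(_ x)]; last by rewrite eqxx.
  case E : [pick y | th y == th x] => [z|]; last first.
    by move: E; case: pickP => // /(_ x); rewrite eqxx.
  exists z; first by rewrite mem_pmap; apply/mapP; exists (th x); rewrite ?mem_enum.
  by move: E; case: pickP => // w /eqP wx [<-].
(* Otherwise some f to [Zmod q] kills [s] but not some x, although an element of [s] has the same
   profile as x. *)
have gens : <<[set:: s]>>%G = [set: H]%G.
  apply/eqP; apply: contraT => ns; rewrite -val_eqE /= in ns.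
  have : <<[set:: s]>>%G \proper [set: H]%SET by rewrite finset.properEneq ns finset.subsetT.
  case/prime_quotient_hom => q [q_pr qH [f [fh f0 [x fx]]]].
  have qa : q \in primes a.
    rewrite mem_primes q_pr a0 /=.
    have [y _ oy] : {y | y \in [set: H]%G & #[y]%g = q} by apply: Cauchy; rewrite ?cardsT.
    by rewrite -oy order_dvdn; apply/eqP; exact: aH.
  have [y ys yx] := sth x.
  have qlea : (q < a.+1)%N.
    by move: qa; rewrite mem_primes => /and3P[_ _ /dvdn_leq]; rewrite ltnS; apply.
  have jr : (index f (enum (homs H (Zmod q))) < r)%N.
    by apply: leq_trans (hr q qa); rewrite /nHom cardE index_mem mem_enum.
  have := congr1 (fun v : V => val (v (Ordinal qlea, Ordinal jr))) yx.
  rewrite /th !ffunE /= nth_index ?mem_enum //.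
  have lt z : (f z < a.+1)%N.
    apply: leq_trans qlea; rewrite ltnS ltnW //.
    by apply: (leq_trans (ltn_ord (f z))); rewrite prednK // prime_gt0.
  rewrite !inordK // => /val_inj fyx.
  have fy0 : f y = 0 by apply: f0; apply: mem_gen; rewrite finset.inE.
  by rewrite -fyx fy0 eqxx in fx.
rewrite -cardsT -[[set: H]%SET]/(gval [set: H]%G) -gens.
apply: (@leq_trans (a ^ size s)); last exact: (leq_pexp2l a0 ss).
apply: card_gen_le; first exact: (zmod_abelian [set: H]%G).
move=> x; apply: dvdn_leq => //; rewrite order_dvdn; apply/eqP; exact: aH.
Qed.

(** A group of order n <= N is determined up to isomorphism by its subtraction table on ['I_n], and
    there are finitely many tables. *)
Lemma reps_finite (a N : nat) (I : choiceType) (S : I -> finZmodType) :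
  iso_class_reps a S -> finite_set [set i | (#|S i| <= N)%N]%classic.
Proof.
move=> [aS uS].
pose code := {n : 'I_N.+1 & {ffun 'I_n * 'I_n -> 'I_n}}.
have mk (i : I) : (#|S i| <= N)%N -> {c : code | exists2 f : S i -> 'I_(tag c),
    bijective f & forall x y, f (x - y) = tagged c (f x, f y)}.
  move=> iN; pose n : 'I_N.+1 := Ordinal (iN : (#|S i| < N.+1)%N).
  exists (Tagged (fun n : 'I_N.+1 => {ffun 'I_n * 'I_n -> 'I_n})
    ([ffun pq : 'I_n * 'I_n => enum_rank (enum_val pq.1 - enum_val pq.2 : S i)] :
      {ffun 'I_n * 'I_n -> 'I_n})).
  exists (@enum_rank (S i)); first exact: enum_rank_bij.
  by move=> x y; rewrite /= ffunE /= !enum_rankK.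
pose F (i : I) : option code :=
  if pselect (#|S i| <= N)%N is left h then Some (sval (mk i h)) else None.
have inj : {in [set i | (#|S i| <= N)%N]%classic &, injective F}.
  move=> i j /set_mem iN /set_mem jN; rewrite /F.
  case: pselect => // hi; case: pselect => // hj [].
  case: (mk i hi) => c [f [f' fK f'K] fB]; case: (mk j hj) => d [h [h' hK h'K] hB] /= cd.
  move: h h' hK h'K hB; rewrite -cd => h h' hK h'K hB.
  have ij : zmod_iso (S i) (S j).
    exists (h' \o f); last by exists (f' \o h) => x /=; rewrite ?h'K ?fK ?f'K ?hK.
    by move=> x y /=; rewrite fB -{1}[f x]h'K -{1}[f y]h'K -hB hK.
  have [l [_ ul]] := uS (S i) (aS i).
  by rewrite -(ul j ij) (ul i (zmod_iso_refl _)).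
have := inj_card_eq inj; rewrite card_eq_sym => /card_eqPle[le _].
exact: card_le_finite le finite_finset.
Qed.

End Boundedness.

(** * Limits of expectations *)

(* The expectation of a random element of I, as a positive linear functional on
   the functions has_mean for it. *)
Record law (R : realType) (I : Type) := Law {
  mean : (I -> R) -> R;
  has_mean : (I -> R) -> Prop;
  has_mean_le : forall f g, has_mean g -> (forall i, `|f i| <= `|g i|)%R -> has_mean f;
  has_meanD : forall f g, has_mean f -> has_mean g -> has_mean (fun i => f i + g i)%R;
  has_meanZ : forall c f, has_mean f -> has_mean (fun i => c * f i)%R;
  meanD : forall f g, has_mean f -> has_mean g ->
    mean (fun i => f i + g i)%R = (mean f + mean g)%R;
  meanZ : forall c f, has_mean f -> mean (fun i => c * f i)%R = (c * mean f)%R;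
  mean_le : forall f g, has_mean f -> has_mean g -> (forall i, f i <= g i)%R ->
    (mean f <= mean g)%R }.

Section Tends.
Local Open Scope classical_set_scope.
Local Open Scope ring_scope.
Variables (R : realType) (I : Type) (Q : nat -> law R I).

Definition tends (f : I -> R) (l : R) :=
  (\forall n \near \oo, has_mean (Q n) f) /\ mean (Q n) f @[n --> \oo] --> l.

(** A total choice of limit, 0 if there is none, so that limits can be indexed by a family and
    summed. *)
Definition tlim (f : I -> R) : R := xget 0 [set l | tends f l].

Lemma tlimP (f : I -> R) : (exists l, tends f l) -> tends f (tlim f).
Proof. by case=> l tl; exact: (@xgetPex _ 0 [set l | tends f l] (ex_intro _ l tl)). Qed.

Lemma tends_near (f : I -> R) (l : R) (u : nat -> R) :
  (\forall n \near \oo, has_mean (Q n) f) ->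
  (\forall n \near \oo, mean (Q n) f = u n) -> u n @[n --> \oo] --> l -> tends f l.
Proof.
move=> sf fu ul; split=> //; apply: cvg_trans ul; apply: near_eq_cvg.
by near=> n; rewrite (near fu n).
Unshelve. all: by end_near. Qed.

Lemma tendsD f g l m : tends f l -> tends g m -> tends (fun i => f i + g i) (l + m).
Proof.
move=> [sf fl] [sg gm]; apply: (tends_near _ _ (cvgD fl gm)).
- by near=> n; apply: has_meanD; near: n.
- by near=> n; rewrite meanD //; near: n.
Unshelve. all: by end_near. Qed.

Lemma tendsZ c f l : tends f l -> tends (fun i => c * f i) (c * l).
Proof.
move=> [sf fl]; apply: (tends_near _ _ (cvgM (cvg_cst c) fl)).
- by near=> n; apply: has_meanZ; near: n.
- by near=> n; rewrite meanZ //; near: n.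
Unshelve. all: by end_near. Qed.

Lemma tendsB f g l m : tends f l -> tends g m -> tends (fun i => f i - g i) (l - m).
Proof.
move=> tf /(tendsZ (-1)) tg; have := tendsD tf tg; rewrite mulN1r.
by congr (tends _ _); apply/funext => i; rewrite mulN1r.
Qed.

(** In a [law] the zero function has a mean once some function has one; the argument [h] of
    [tends_sum] plays the part of [f] here. *)
Lemma tends0 f l : tends f l -> tends (fun=> 0) 0.
Proof.
move=> /(tendsZ 0); rewrite mul0r.
by congr (tends _ _); apply/funext => i; rewrite mul0r.
Qed.

Lemma tends_sum (J : Type) (r : seq J) (P : pred J) (F : J -> I -> R) (l : J -> R) h m :
  tends h m -> (forall j, P j -> tends (F j) (l j)) ->
  tends (fun i => \sum_(j <- r | P j) F j i) (\sum_(j <- r | P j) l j).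
Proof.
move=> th tF; elim: r => [|j r IH].
  rewrite big_nil; have := tends0 th.
  by congr (tends _ _); apply/funext => i; rewrite big_nil.
rewrite big_cons; case: ifP => Pj.
  have := tendsD (tF j Pj) IH.
  by congr (tends _ _); apply/funext => i; rewrite big_cons Pj.
by move: IH; congr (tends _ _); apply/funext => i; rewrite big_cons Pj.
Qed.

Lemma tends_le f g l m : tends f l -> tends g m -> (forall i, f i <= g i) -> l <= m.
Proof.
move=> [sf fl] [sg gm] fg; apply: (ler_cvg_to fl gm).
by near=> n; apply: mean_le => //; near: n.
Unshelve. all: by end_near. Qed.

(** Domination by |g| + u gives [f] a mean. This mean is eventually within a prescribed distance of
    the limit for [g], so the means form a Cauchy sequence. *)
Lemma tends_approx f :
  (forall e : R, 0 < e -> exists g u l m, [/\ tends g l, tends u m, m <= e &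
     forall i, `|f i - g i| <= u i]) ->
  exists l, tends f l.
Proof.
move=> H.
have sf : \forall n \near \oo, has_mean (Q n) f.
  have [g [u [l [m [[sg _] [su _] _ fgu]]]]] := H 1 ltr01.
  near=> n.
  have sg' : has_mean (Q n) (fun i => `|g i|).
    by apply: (@has_mean_le _ _ _ _ g) => [|i]; [near: n | rewrite normr_id].
  have su' : has_mean (Q n) u by near: n.
  apply: (has_mean_le (has_meanD sg' su')) => i.
  have gu : 0 <= `|g i| + u i.
    by rewrite addr_ge0 // (le_trans (normr_ge0 (f i - g i))).
  rewrite (ger0_norm gu) -{1}[f i](subrK (g i)) addrC (le_trans (ler_normD _ _)) //.
  by rewrite lerD2l.
suff : cvgn (fun n => mean (Q n) f) by move=> /cvg_ex[l fl]; exists l.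
apply/cauchy_cvgP/cauchy_exP => e e0.
(* The error is at most e/4 from the mean of [g] and e/4 + e/4 from that of [u], whose limit is at
   most e/4. *)
have e4 : 0 < e / 4 by rewrite divr_gt0.
have [g [u [l [m [[sg gl] [su um] me fgu]]]]] := H (e / 4) e4.
exists l; rewrite -ball_normE.
suff : \forall n \near \oo, `|l - mean (Q n) f| < e by [].
move/cvgrPdist_le : (gl) => /(_ (e / 4) e4) gl'.
move/cvgrPdist_le : (um) => /(_ (e / 4) e4) um'.
near=> n.
have sfn : has_mean (Q n) f by near: n.
have sgn : has_mean (Q n) g by near: n.
have sun : has_mean (Q n) u by near: n.
have h1 : mean (Q n) f <= mean (Q n) g + mean (Q n) u.
  rewrite -meanD //; apply: mean_le => //; first exact: has_meanD.
  by move=> i; have := fgu i; rewrite ler_norml; lra.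
have h2 : mean (Q n) g <= mean (Q n) f + mean (Q n) u.
  rewrite -meanD //; apply: mean_le => //; first exact: has_meanD.
  by move=> i; have := fgu i; rewrite ler_norml; lra.
have h3 : `|l - mean (Q n) g| <= e / 4 by near: n.
have h4 : `|m - mean (Q n) u| <= e / 4 by near: n.
move: h3 h4; rewrite !ler_norml ltr_norml; lra.
Unshelve. all: by end_near. Qed.

End Tends.

(** * Lagrange interpolation at the powers of p *)

Section Lagrange.
Local Open Scope ring_scope.
Variable R : realFieldType.

Definition lagrange_pow (p s m : nat) : {poly R} :=
  \prod_(j < m.+1 | j != s :> nat)
    ((p%:R ^+ s - p%:R ^+ j)^-1 *: ('X - (p%:R ^+ j)%:P)).

(** If r <= m, then p^r is a node and the difference vanishes. If r > m, the indicator is 0 and each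
    factor is at most 2 p^r / p^j, because |p^s - p^j| >= p^j / 2 for j != s; the factor p^s of the
    bound makes up for the missing node j = s. *)
Lemma lagrange_pow_approx (p s m r : nat) : (1 < p)%N -> (s <= m)%N ->
  `|(r == s)%:R - (lagrange_pow p s m).[p%:R ^+ r]| <=
  2 ^+ m * p%:R ^+ s / p%:R ^+ (\sum_(j < m.+1) j) * (p%:R ^+ r) ^+ m.
Proof.
move=> p1 sm.
have p0 : 0 < p%:R :> R by rewrite ltr0n; lia.
have p2 : 2 <= p%:R :> R by rewrite ler_nat.
have pow_le (i j : nat) : (i < j)%N -> 2 * p%:R ^+ i <= p%:R ^+ j :> R.
  move=> ij; apply: (@le_trans _ _ (p%:R ^+ i.+1)).
    by rewrite exprS ler_pM2r // exprn_gt0.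
  by rewrite ler_weXn2l // (le_trans _ p2) // ler1n.
have eL : (lagrange_pow p s m).[p%:R ^+ r] =
    \prod_(j < m.+1 | j != s :> nat) ((p%:R ^+ s - p%:R ^+ j)^-1 * (p%:R ^+ r - p%:R ^+ j)).
  by rewrite horner_prod; apply: eq_bigr => j _; rewrite !hornerE.
have pow_neq (i j : nat) : i != j -> p%:R ^+ i - p%:R ^+ j != 0 :> R.
  move=> ij; rewrite subr_eq0; apply/eqP => e.
  have hi : 0 < p%:R ^+ i :> R by rewrite exprn_gt0.
  have hj : 0 < p%:R ^+ j :> R by rewrite exprn_gt0.
  by move: ij; rewrite neq_ltn => /orP[] /pow_le; lra.
have rhs0 : 0 <= 2 ^+ m * p%:R ^+ s / p%:R ^+ (\sum_(j < m.+1) j) * (p%:R ^+ r) ^+ m :> R.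
  by rewrite !mulr_ge0 ?invr_ge0 ?exprn_ge0 // ltW.
rewrite eL; case: (leqP r m) => rm.
  case: (eqVneq r s) => [->|rs].
    rewrite big1 ?subrr ?normr0 // => j js.
    by rewrite mulVf // pow_neq // eq_sym.
  have rm' : (r < m.+1)%N by [].
  by rewrite (bigD1 (Ordinal rm')) //= subrr mulr0 mul0r subrr normr0.
have -> : (r == s) = false by apply/eqP; lia.
rewrite sub0r normrN normr_prod.
apply: (@le_trans _ _ (\prod_(j < m.+1 | j != s :> nat) (2 / p%:R ^+ j * p%:R ^+ r))).
  apply: ler_prod => j js; rewrite normr_ge0 /= normrM.
  have pj : 0 < p%:R ^+ j :> R by rewrite exprn_gt0.
  have ps : 0 < p%:R ^+ s :> R by rewrite exprn_gt0.
  apply: ler_pM => //.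
    have h : p%:R ^+ j / 2 <= `|p%:R ^+ s - p%:R ^+ j| :> R.
      rewrite ler_normr; move: js; rewrite neq_ltn => /orP[] /pow_le h; apply/orP.
        by left; lra.
      by right; lra.
    rewrite normfV -[2 / _]invf_div lef_pV2 // posrE ?divr_gt0 //.
    by apply: lt_le_trans h; rewrite divr_gt0.
  have jr : (j < r)%N by rewrite (leq_ltn_trans _ rm) // -ltnS.
  have h := pow_le _ _ jr.
  by rewrite ger0_norm; lra.
rewrite !big_split /= !prodr_const.
have -> : #|[pred j : 'I_m.+1 | j != s :> nat]| = m.
  have sm' : (s < m.+1)%N by [].
  have := cardC1 (Ordinal sm'); rewrite card_ord /= => cm.
  apply: etrans cm; apply: eq_card => j; by rewrite !inE.
rewrite ler_pM2r ?exprn_gt0 // -mulrA ler_pM2l ?exprn_gt0 //.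
have sm' : (s < m.+1)%N by [].
rewrite prodfV (big_morph _ (exprD p%:R) (expr0 _)) (bigD1 (Ordinal sm') (P := xpredT)) //=.
by rewrite invfM mulrA divff ?mul1r ?expf_neq0 ?lt0r_neq0.
Qed.

End Lagrange.

(** * Interpolation error against the number of chains *)

Section Growth.
Local Open Scope nat_scope.

Lemma gauss_sum_ord (m : nat) : m ^ 2 <= (\sum_(j < m.+1) j).*2.
Proof.
elim: m => [|m IH]; first by [].
by rewrite big_ord_recr /=; move: (\sum_(j < m.+1) j) IH => S; nia.
Qed.

(** The gap between k/(k+1) and 1 is worth p^(t m): indeed t m + 2 k (k+1) t^2 = m^2 / 2, which is
    at most the sum of the j <= m. The number [t] is chosen so that p^(t m) absorbs the exponential
    factor (2 (k+1) #|G|)^m and the gain 2^u. *)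
Lemma card_chains_powZ_le (k p s u t m : nat) (G : finZmodType) : prime p ->
  t = 2 * (k.+1 * #|G|) + u.+1 -> m = t * (k.+1).*2 ->
  2 ^ m * p ^ s * #|chains k [set: powZ p m G]%G| * 2 ^ u <=
  p ^ s * (2 ^ #|G|) ^ k * p ^ (\sum_(j < m.+1) j).
Proof.
move=> p_pr tE mE; set c := #|G|; set D := 2 * (k.+1 * c).
have p1 := prime_gt1 p_pr.
have t0 : 0 < t by rewrite tE addnS.
have m0 : 0 < m by rewrite mE muln_gt0 t0.
have cE : #|[set: powZ p m G]%G| = c * p ^ m.
  by rewrite cardsT card_powZ // prime_gt0.
have := card_chains_bound p_pr (zmod_abelian [set: powZ p m G]%G)
  (etrans cE (congr1 (fun e => c * p ^ e) mE)).
rewrite -mE => hK.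
apply: (@leq_trans (2 ^ m * p ^ s *
  ((2 ^ c) ^ k * (k.+1 * c) ^ m * p ^ (k * k.+1 * t ^ 2).*2) * 2 ^ u)).
  by rewrite !leq_mul.
have -> : 2 ^ m * p ^ s * ((2 ^ c) ^ k * (k.+1 * c) ^ m * p ^ (k * k.+1 * t ^ 2).*2) * 2 ^ u
   = p ^ s * (2 ^ c) ^ k * (D ^ m * 2 ^ u * p ^ (k * k.+1 * t ^ 2).*2).
  by rewrite /D [(2 * _) ^ m]expnMn; ring.
rewrite leq_mul //.
apply: (@leq_trans (p ^ (t * m) * p ^ (k * k.+1 * t ^ 2).*2)).
  rewrite leq_mul //; apply: (@leq_trans (2 ^ (t * m))); last by rewrite leq_exp2r // muln_gt0 t0.
  apply: (@leq_trans (2 ^ (D * m) * 2 ^ (u * m))).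
    apply: leq_mul; last by rewrite leq_exp2l // leq_pmulr.
    by rewrite expnM leq_exp2r // ltnW // ltn_expl.
  by rewrite -expnD leq_exp2l // tE -mulnDl leq_mul2r leq_add2l leqnSn orbT.
rewrite -expnD leq_exp2l // -leq_double; apply: leq_trans (gauss_sum_ord m).
by rewrite mE -!muln2; lia.
Qed.

End Growth.

(** * The moment problem *)

Section MomentProblem.
Local Open Scope classical_set_scope.
Local Open Scope ring_scope.
Variables (R : realType) (k a : nat) (I : choiceType) (S : I -> finZmodType).
Variable Q : nat -> law R I.
Hypotheses (k_gt0 : (0 < k)%N) (a_gt0 : (0 < a)%N) (repsS : iso_class_reps a S).

Let hom (G : finZmodType) (i : I) : R := (nHom (S i) G)%:R.
Let sur (G : finZmodType) (i : I) : R := (nSur (S i) G)%:R.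

Hypothesis mom : forall G, exponent_dvd a G -> tends Q (sur G) (n_chains k G)%:R.

Lemma tends_hom G : exponent_dvd a G ->
  exists2 l, tends Q (hom G) l & l <= #|chains k [set: G]%SET|%:R.
Proof.
move=> aG; exists (\sum_(B : {group G}) (n_chains k (subZ B))%:R).
  have -> : hom G = fun i => \sum_(B : {group G}) sur (subZ B) i.
    by apply/funext => i; rewrite /hom nHom_sum_nSur natr_sum.
  apply: (tends_sum _ (mom aG)) => B _; apply: mom; exact: exponent_dvd_subZ.
by rewrite -natr_sum ler_nat sum_n_chains_le.
Qed.

(** Weights that can be inserted into all Hom-moments without losing convergence. Indicators of the
    values of z_p are inserted one prime at a time. *)
Definition stable (delta : I -> R) :=
  forall G, exponent_dvd a G -> exists l, tends Q (fun i => hom G i * delta i) l.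

Lemma stable1 : stable (fun=> 1).
Proof.
move=> G aG; have [l tl _] := tends_hom aG; exists l.
by move: tl; congr (tends _ _); apply/funext => i; rewrite mulr1.
Qed.

(** By [nHom_powZ], a factor z_p^j turns the weighted moment of [G] into that of G x F_p^j. *)
Lemma stable_horner (delta : I -> R) (p : nat) (L : {poly R}) G :
  prime p -> (p %| a)%N -> stable delta -> exponent_dvd a G ->
  exists l, tends Q (fun i => hom G i * delta i * L.[hom (Zmod p) i]) l.
Proof.
move=> p_pr pa sd aG; have p0 := prime_gt0 p_pr.
pose l j := tlim Q (fun i => hom (powZ p j G) i * delta i).
have lP j : tends Q (fun i => hom (powZ p j G) i * delta i) (l j).
  have [l' tl'] := sd _ (exponent_dvd_powZ j p0 pa aG).
  by apply: tlimP; exists l'.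
exists (\sum_(j < size L) L`_j * l j).
have -> : (fun i => hom G i * delta i * L.[hom (Zmod p) i]) =
   (fun i => \sum_(j < size L) L`_j * (hom (powZ p j G) i * delta i)).
  apply/funext => i; rewrite horner_coef mulr_sumr; apply: eq_bigr => j _.
  by rewrite /hom nHom_powZ natrM natrX; ring.
by apply: (tends_sum _ (lP 0)) => j _; apply: tendsZ.
Qed.

Lemma stable_prime (delta : I -> R) (p s : nat) : prime p -> (p %| a)%N ->
  (forall i, 0 <= delta i <= 1) -> stable delta ->
  stable (fun i => delta i * (nHom (S i) (Zmod p) == p ^ s)%N%:R).
Proof.
move=> p_pr pa d01 sd G aG; apply: tends_approx => e e0.
have p1 := prime_gt1 p_pr; have p0 := ltnW p1.
pose C : R := ((p ^ s * (2 ^ #|G|) ^ k)%N)%:R.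
(* The bound C / 2^u <= e is the final error on average; u >= s gives s <= m, so that p^s is among
   the nodes. *)
have [u [us uC]] : exists u : nat, (s <= u)%N /\ C / 2 ^+ u <= e.
  pose v := Num.bound (C / e).
  exists (s + v)%N; split; first exact: leq_addr.
  rewrite ler_pdivrMr ?exprn_gt0 // mulrC -ler_pdivrMr //.
  apply: ltW; apply: lt_le_trans (archi_boundP _) _; first by rewrite divr_ge0 // ltW.
  by rewrite -natrX ler_nat -/v (leq_trans (leq_addl s v)) // ltnW // ltn_expl.
pose t := (2 * (k.+1 * #|G|) + u.+1)%N; pose m := (t * (k.+1).*2)%N.
have sm : (s <= m)%N.
  have tm : (t <= m)%N by rewrite /m leq_pmulr // double_gt0.
  by apply: leq_trans tm; rewrite /t; lia.
pose A : R := 2 ^+ m * p%:R ^+ s / p%:R ^+ (\sum_(j < m.+1) j).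
have A0 : 0 <= A by rewrite divr_ge0 ?mulr_ge0 ?exprn_ge0.
have [lg tg] := stable_horner (lagrange_pow R p s m) p_pr pa sd aG.
have [lu tu leu] := tends_hom (exponent_dvd_powZ m p0 pa aG).
exists (fun i => hom G i * delta i * (lagrange_pow R p s m).[hom (Zmod p) i]).
(* The pointwise error [A * z_p^m * hom G] is a multiple of a Hom-moment of G x F_p^m, whose limit
   is bounded by a number of chains. *)
exists (fun i => A * hom (powZ p m G) i), lg, (A * lu); split => //.
- exact: tendsZ.
- apply: le_trans uC; apply: le_trans (ler_wpM2l A0 leu) _.
  have := card_chains_powZ_le (k := k) s (G := G) p_pr (erefl t) (erefl m).
  rewrite -(ler_nat R) natrM [leRHS]natrM -/C !natrM !natrX => h.
  have P0 : 0 < p%:R ^+ (\sum_(j < m.+1) j) :> R by rewrite exprn_gt0 // ltr0n.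
  rewrite ler_pdivlMr ?exprn_gt0 //.
  have -> (x y : R) : A * x * y = 2 ^+ m * p%:R ^+ s * x * y / p%:R ^+ (\sum_(j < m.+1) j).
    by rewrite /A; field; rewrite expf_neq0 // pnatr_eq0 -lt0n.
  by rewrite ler_pdivrMr.
- move=> i; have [r hr] := nHom_prime (S i) p_pr.
  have -> : hom G i * (delta i * (nHom (S i) (Zmod p) == (p ^ s)%N)%:R) -
     hom G i * delta i * (lagrange_pow R p s m).[hom (Zmod p) i] =
     hom G i * delta i * ((r == s)%:R - (lagrange_pow R p s m).[p%:R ^+ r]).
    by rewrite hr eqn_exp2l // /hom hr natrX; ring.
  have /andP[d0 d1] := d01 i.
  have h0 : 0 <= hom G i by exact: ler0n.
  rewrite normrM ger0_norm ?mulr_ge0 //.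
  apply: (@le_trans _ _ (hom G i * 1 * (A * (p%:R ^+ r) ^+ m))).
    apply: ler_pM => //; first exact: mulr_ge0.
      exact: ler_wpM2l.
    exact: lagrange_pow_approx.
  by rewrite /hom nHom_powZ natrM natrX hr natrX le_eqVlt; apply/orP; left; apply/eqP; ring.
Qed.

Lemma stable_all (ps : seq nat) (K : finZmodType) :
  {subset ps <= primes a} ->
  stable (fun i => (all (fun p => nHom (S i) (Zmod p) == nHom K (Zmod p)) ps)%:R).
Proof.
elim: ps => [|p ps IH] sps; first exact: stable1.
have : p \in primes a by apply: sps; rewrite mem_head.
rewrite mem_primes => /and3P[p_pr _ pa].
have [s hs] := nHom_prime K p_pr.
have sps' : {subset ps <= primes a} by move=> q qs; apply: sps; rewrite inE qs orbT.
have d01 i : 0 <= ((all (fun p => nHom (S i) (Zmod p) == nHom K (Zmod p)) ps)%:R : R) <= 1.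
  by case: all; rewrite /= ?lexx ?ler01.
have := stable_prime s p_pr pa d01 (IH sps').
congr stable; apply/funext => i /=; rewrite hs.
by rewrite -natrM mulnb andbC.
Qed.

Lemma nSur_target_iso (H G G' : finZmodType) : zmod_iso G G' -> nSur H G = nSur H G'.
Proof.
have le (G1 G2 : finZmodType) : zmod_iso G1 G2 -> (nSur H G1 <= nSur H G2)%N.
  move=> [f fM [f' fK f'K]]; rewrite !nSur_surs.
  pose F (g : {ffun H -> G1}) : {ffun H -> G2} := [ffun x => f (g x)].
  have Finj : injective F.
    move=> g g' /ffunP e; apply/ffunP => x; apply: (can_inj fK).
    by move: (e x); rewrite !ffunE.
  rewrite -(card_imset _ Finj).
  apply/subset_leq_card/fintype.subsetP => _ /imsetP[g /sursP[gM gS] ->].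
  apply/sursP; split=> [x y|y]; first by rewrite !ffunE gM fM.
  by have [x ex] := gS (f' y); exists x; rewrite ffunE -ex f'K.
by move=> i; apply/eqP; rewrite eqn_leq !le //; exact: zmod_iso_sym.
Qed.

Lemma subZ_setT_iso (G : finZmodType) : zmod_iso (subZ [set: G]%G) G.
Proof.
have inT (x : G) : in_subgroup [set: G]%G x by rewrite /in_subgroup finset.in_setT.
exists (val : subZ [set: G]%G -> G); first by move=> x y; exact: raddfB.
exists (fun x => exist _ x (inT x) : subZ [set: G]%G) => [x|x //].
exact: val_inj.
Qed.

(** Induction on the order of [G] in place of Moebius inversion: surjections are the homomorphisms
    minus the surjections onto proper subgroups. *)
Lemma stable_sur (delta : I -> R) : stable delta ->
  forall G, exponent_dvd a G -> exists l, tends Q (fun i => sur G i * delta i) l.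
Proof.
move=> sd G; have [n] := ubnP #|G|; elim: n => // n IH in G *; rewrite ltnS => Gn aG.
have [lh th] := sd _ aG.
pose F (B : {group G}) := fun i => sur (subZ B) i * delta i.
pose l B := tlim Q (F B).
have lP B : B != [set: G]%G -> tends Q (F B) (l B).
  move=> BT; have [|l' tl'] := IH (subZ B) _ (exponent_dvd_subZ B aG).
    rewrite card_subZ; apply: leq_trans Gn; rewrite -cardsT; apply: proper_card.
    by rewrite finset.properEneq finset.subsetT andbT.
  by apply: tlimP; exists l'.
have := tendsB th (tends_sum (index_enum _) th lP) => tB.
exists (lh - \sum_(B | B != [set: G]%G) l B); move: tB.
congr (tends _ _); apply/funext => i.
rewrite /hom nHom_sum_nSur (bigD1 [set: G]%G) //= (nSur_target_iso _ (subZ_setT_iso G)).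
by rewrite natrD mulrDl natr_sum mulr_suml addrK.
Qed.

Lemma finite_small_homs (r : nat) :
  finite_set [set i | all (fun p => nHom (S i) (Zmod p) <= r)%N (primes a)].
Proof.
apply: sub_finite_set (reps_finite (a ^ (a.+1 ^ (a.+1 * r))) repsS) => i /= /allP h.
by apply: card_le_of_nHom => //; exact: repsS.1.
Qed.

(** The triangularity of the matrix #Sur(S j, S i), ordered by the orders of the groups. *)
Lemma nSur_reps (i j : I) : (0 < nSur (S j) (S i))%N -> j != i -> (#|S i| < #|S j|)%N.
Proof.
move=> sij ji; rewrite ltn_neqAle nSur_gt0_leq // andbT.
apply: contra ji => /eqP ij; have [l [_ ul]] := repsS.2 (S j) (repsS.1 j).
by rewrite -(ul j (zmod_iso_refl _)) (ul i (nSur_gt0_iso sij (esym ij))).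
Qed.

(** On the finite set [A] of indices with the same z_p as [i0] for all p | a, the function
    [sur (S i1)] is [c i1] times the indicator of [i1] plus multiples of indicators of strictly
    larger groups. The system is solved from the largest groups down. *)
Lemma tends_indic (i0 : I) : exists l, tends Q (fun i => (i == i0)%:R) l.
Proof.
pose same i := all (fun p => nHom (S i) (Zmod p) == nHom (S i0) (Zmod p)) (primes a).
pose r := (\sum_(p <- primes a) nHom (S i0) (Zmod p))%N.
have finA : finite_set [set i | same i].
  apply: sub_finite_set (finite_small_homs r) => i /= /allP h.
  apply/allP => p pa; rewrite (eqP (h p pa)) /r (big_rem p pa) /=; exact: leq_addr.
pose A := fset_set [set i | same i].
have inA i : (i \in A) = same i.
  by rewrite in_fset_set //; apply/idP/idP => [/set_mem|si]; last exact: mem_set.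
pose N := (\sum_(j <- A) #|S j|)%N.
have leN i : same i -> (#|S i| <= N)%N.
  move=> si; have iA : i \in (A : seq I) by rewrite inA.
  by rewrite /N (big_rem i iA) /=; exact: leq_addr.
(* Downward induction on the order of [S i1], measured by its distance to the common bound [N]. *)
suff H n : forall i1, same i1 -> (N - #|S i1| < n)%N -> exists l, tends Q (fun i => (i == i1)%:R) l.
  by apply: (H (N - #|S i0|).+1 i0) => //; apply/allP.
elim: n => // n IH i1 s1 Nn.
pose l j := tlim Q (fun i => (i == j)%:R).
have lP j : same j && (#|S i1| < #|S j|)%N -> tends Q (fun i => (i == j)%:R) (l j).
  move=> /andP[sj ij]; have [||l' tl'] := IH j => //.
    by have := leN j sj; have := leN i1 s1; lia.
  by apply: tlimP; exists l'.
have [ls ts] := stable_sur (stable_all (S i0) (fun p => id)) (repsS.1 i1).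
pose c j : R := (nSur (S j) (S i1))%:R.
have tB := tendsB ts (tends_sum A ts (fun j Pj => tendsZ (c j) (lP j Pj))).
exists ((c i1)^-1 * (ls - \sum_(j <- A | same j && (#|S i1| < #|S j|)%N) c j * l j)).
move: (tendsZ (c i1)^-1 tB); congr (tends _ _); apply/funext => i.
have c1 : c i1 != 0 by rewrite pnatr_eq0 -lt0n nSur_self_gt0.
apply: (mulfI c1); rewrite mulrA mulfV // mul1r -/(same i) /sur.
case si: (same i); last first.
  rewrite mulr0 sub0r big1 ?oppr0.
    by case: eqP => [ii|_]; rewrite ?mulr0 //; rewrite ii s1 in si.
  move=> j /andP[sj _]; case: eqP => [ij|_]; rewrite ?mulr0 //.
  by rewrite ij sj in si.
rewrite mulr1; have iA : i \in (A : seq I) by rewrite inA.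
rewrite (bigID (pred1 i)) /= [X in _ - (_ + X)]big1 ?addr0; last first.
  by move=> j /andP[_ ji]; rewrite eq_sym (negbTE ji) mulr0.
rewrite -big_filter.
(* At a given [i], only the term j = i of the sum can survive, and it does when [S i] is larger than
   [S i1]. *)
have -> : [seq j <- A | same j && (#|S i1| < #|S j|)%N && (j == i)] =
    if (#|S i1| < #|S i|)%N then [:: i] else [::].
  rewrite (eq_filter (a2 := fun j => (#|S i1| < #|S i|)%N && (j == i))); last first.
    by move=> j /=; case: eqP => [->|]; rewrite ?si ?andbF.
  case: ifP => _ /=; last by rewrite filter_pred0.
  by rewrite filter_pred1_uniq // fset_uniq.
case: (eqVneq i i1) => [->|ii1].
  by rewrite ltnn big_nil subr0 mulr1.
rewrite mulr0; case: ifP => h.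
  by rewrite big_seq1 eqxx mulr1 subrr.
rewrite big_nil subr0; apply/eqP; rewrite pnatr_eq0 -leqn0 leqNgt.
by apply/negP => /nSur_reps/(_ ii1); rewrite h.
Qed.

Definition limit_law (i : I) : R := tlim Q (fun j => (j == i)%:R).

Lemma limit_lawP i : tends Q (fun j => (j == i)%:R) (limit_law i).
Proof. exact: tlimP (tends_indic i). Qed.

Lemma tends_restrict (A : {fset I}) (G : finZmodType) :
  tends Q (fun i => sur G i * (i \in A)%:R) (\sum_(i <- A) limit_law i * (nSur (S i) G)%:R).
Proof.
(* [tends_sum] needs one convergent function, and an element of [I] provides it. If there is none,
   all functions on [I] coincide and the moment of the trivial group provides it. *)
case: (pselect (exists i0 : I, True)) => [[i0 _]|nI].
  have := tends_sum A (P := xpredT) (limit_lawP i0)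
    (fun j _ => tendsZ (sur G j) (limit_lawP j)).
  congr (tends _ _); last by apply: eq_bigr => j _; rewrite mulrC.
  apply/funext => i; case iA: (i \in A).
    rewrite (big_fsetD1 i) //= eqxx big_seq big1 ?addr0 ?mulr1 // => j.
    by rewrite !inE => /andP[ji _]; rewrite eq_sym (negbTE ji) mulr0.
  rewrite mulr0 big_seq big1 // => j jA.
  by case: eqP => [ij|_]; rewrite ?mulr0 //; rewrite ij jA in iA.
have -> : A = fset0 by apply/fsetP => i; exfalso; apply: nI; exists i.
rewrite big_seq_fset0.
have a1 : exponent_dvd a (Zmod 1) by apply: exponent_dvd_Zmod; rewrite ?dvd1n.
have := tends0 (mom a1).
by congr (tends _ _); apply/funext => i; exfalso; apply: nI; exists i.
Qed.

Lemma limit_moment_le (A : {fset I}) (G : finZmodType) : exponent_dvd a G ->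
  \sum_(i <- A) limit_law i * (nSur (S i) G)%:R <= (n_chains k G)%:R.
Proof.
move=> aG; apply: (tends_le (tends_restrict A G) (mom aG)) => i.
by rewrite ler_piMr ?ler0n //; case: (_ \in _); rewrite ?ler01.
Qed.

(** Tightness by Markov's inequality: outside [A] some p | a has z_p >= r+1, hence #Sur <= #Hom <=
    #Hom z_p / (r+1), and the limiting mean of this bound, summed over p, is C / (r+1) <= e. *)
Lemma limit_moment_ge (e : R) (G : finZmodType) : exponent_dvd a G -> 0 < e ->
  exists A : {fset I},
    (n_chains k G)%:R - e <= \sum_(i <- A) limit_law i * (nSur (S i) G)%:R.
Proof.
move=> aG e0.
pose l p := tlim Q (hom (prodZ (Zmod p) G)).
have lP p : p \in primes a -> tends Q (hom (prodZ (Zmod p) G)) (l p).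
  rewrite mem_primes => /and3P[p_pr _ pa]; have p0 := prime_gt0 p_pr.
  have [l' tl' _] := tends_hom (exponent_dvd_prod (exponent_dvd_Zmod p0 pa) aG).
  by apply: tlimP; exists l'.
(* The filter repeats the range of the sum, so that [p \in primes a] is available for each term. *)
pose C := \sum_(p <- primes a | p \in primes a) l p.
have tC : tends Q (fun i => \sum_(p <- primes a | p \in primes a) hom (prodZ (Zmod p) G) i) C.
  exact: (tends_sum _ (mom aG)).
have C0 : 0 <= C.
  by apply: (tends_le (tends0 tC) tC) => i; rewrite sumr_ge0 // => p _; exact: ler0n.
pose r := Num.bound (C / e).
have r0 : 0 < r.+1%:R :> R by rewrite ltr0n.
pose A := fset_set [set i | all (fun p => nHom (S i) (Zmod p) <= r)%N (primes a)].
exists A.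
have := tends_le (tendsB (mom aG) (tends_restrict A G)) (tendsZ (r.+1%:R)^-1 tC).
have Ce : (r.+1%:R)^-1 * C <= e.
  rewrite mulrC ler_pdivrMr // mulrC -ler_pdivrMr //.
  apply: ltW; apply: lt_le_trans (archi_boundP _) _; first by rewrite divr_ge0 // ltW.
  by rewrite ler_nat -/r leqnSn.
move=> h.
suff : (n_chains k G)%:R - \sum_(i <- A) limit_law i * (nSur (S i) G)%:R <=
    r.+1%:R^-1 * C.
  by move=> /le_trans/(_ Ce) h'; rewrite lerBlDr -lerBlDl.
apply: h => i.
have homs0 : 0 <= \sum_(p <- primes a | p \in primes a) hom (prodZ (Zmod p) G) i.
  by rewrite sumr_ge0 // => p _; exact: ler0n.
case iA: (i \in A); first by rewrite mulr1 subrr mulr_ge0 // invr_ge0 ltW.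
rewrite mulr0 subr0.
have : ~~ all (fun p => nHom (S i) (Zmod p) <= r)%N (primes a).
  apply: contraFN iA => h'; rewrite in_fset_set; last exact: finite_small_homs.
  exact: mem_set.
case/allPn => p pa; rewrite -ltnNge => rp.
rewrite mulrC ler_pdivlMr // (big_rem p pa) /= pa.
apply: (@le_trans _ _ (hom (prodZ (Zmod p) G) i)); last first.
  by rewrite lerDl sumr_ge0 // => q _; exact: ler0n.
by rewrite /hom nHom_prod /sur -natrM ler_nat mulnC leq_mul // nSur_le_nHom.
Qed.

End MomentProblem.

(** * Tensor products with Z/a *)

Section FiniteCopy.
Variables (A : zmodType) (s : seq A) (mem_s : forall x, x \in s).

Definition finite_copy : Type := A.
HB.instance Definition _ := GRing.Zmodule.on finite_copy.

Lemma finite_copy_can : cancel (index^~ s : finite_copy -> nat) (fun i => nth 0%R s i).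
Proof. by move=> x; rewrite nth_index. Qed.

HB.instance Definition _ : isCountable finite_copy := CanIsCountable finite_copy_can.

Lemma finite_copy_enumP : Finite.axiom (undup s : seq finite_copy).
Proof. by move=> x; rewrite count_uniq_mem ?undup_uniq // mem_undup mem_s. Qed.

HB.instance Definition _ := fintype.isFinite.Build finite_copy finite_copy_enumP.

Lemma finite_zmod_iso : exists H : finZmodType, zmod_iso A H.
Proof. by exists finite_copy; exists id => //; exists id. Qed.

End FiniteCopy.

Section TensorQuotient.
Local Open Scope ring_scope.
Variables (a : nat) (X : zmodType).
Hypothesis a_gt0 : (0 < a)%N.

Let T := tensor X (Zmod a).
Let one : Zmod a := inZp 1.

(** This map presents the tensor product as X/aX: it is onto, its image is killed by a, and
    homomorphisms to groups of exponent dividing a factor through it. *)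
Definition tensor1 (x : X) : T := pure_tensor x one.

Lemma tensor1_morphism : GRing.zmod_morphism tensor1.
Proof.
have [hl _] := pure_tensor_biadditive X (Zmod a).
by move=> x y; apply/eqP; rewrite eq_sym subr_eq -hl subrK.
Qed.

HB.instance Definition _ := GRing.isZmodMorphism.Build X T tensor1 tensor1_morphism.

Lemma pure_tensor0 (x : X) : pure_tensor x (0 : Zmod a) = 0.
Proof.
have [_ hr] := pure_tensor_biadditive X (Zmod a).
by apply: (addrI (pure_tensor x 0)); rewrite -hr !addr0.
Qed.

Lemma pure_tensor1_mulrn (x : X) (n : nat) :
  pure_tensor x (one *+ n) = tensor1 (x *+ n).
Proof.
have [_ hr] := pure_tensor_biadditive X (Zmod a).
by rewrite raddfMn; elim: n => [|n IH]; rewrite ?mulr0n ?pure_tensor0 // !mulrS hr IH.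
Qed.

Lemma pure_tensorE (x : X) (c : Zmod a) : pure_tensor x c = tensor1 (x *+ c).
Proof.
rewrite -pure_tensor1_mulrn; congr pure_tensor; apply: val_inj.
by rewrite Zp_mulrn /= modnMml mul1n modn_small.
Qed.

Lemma tensor1_surj (t : T) : exists x, t = tensor1 x.
Proof.
rewrite -[t]reprK; move: (generic_quotient.repr t) => x; rewrite -[x]freeg_sumE.
rewrite raddf_sum; apply: (big_ind (fun t : T => exists x, t = tensor1 x)).
- by exists 0; rewrite raddf0.
- by move=> _ _ [y ->] [z ->]; exists (y + z); rewrite raddfD.
move=> [y c] _; exists ((y *+ c) *~ coeff (y, c) x).
have -> : tensor1 ((y *+ c) *~ coeff (y, c) x) = pure_tensor y c *~ coeff (y, c) x.
  by rewrite pure_tensorE raddfMz.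
have -> : << coeff (y, c) x *g (y, c) >> =
    free_pure y c *~ coeff (y, c) x :> free_tensor X (Zmod a).
  by rewrite freegU_mulz intz.
by rewrite raddfMz.
Qed.

Lemma tensor1_mulrn (x : X) : tensor1 x *+ a = 0.
Proof.
have -> : tensor1 x *+ a = pure_tensor x (one *+ a).
  by rewrite pure_tensor1_mulrn raddfMn.
have -> : one *+ a = 0.
  by apply: val_inj; rewrite Zp_mulrn /= modnMml mul1n prednK // modnn.
exact: pure_tensor0.
Qed.

Lemma mulrn_modn (G : zmodType) (y : G) (n : nat) : y *+ a = 0 -> y *+ (n %% a) = y *+ n.
Proof. by move=> ya; rewrite {2}(divn_eq n a) mulrnDr mulnC mulrnA ya mul0rn add0r. Qed.

(** The map (x, c) -> c f(x) is well defined on residues because a kills [G]; the universal property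
    applies to it. *)
Lemma tensor1_factor (G : finZmodType) (f : X -> G) : exponent_dvd a G ->
  GRing.zmod_morphism f -> exists g : T -> G, f = g \o tensor1.
Proof.
move=> /exponent_dvdP aG fM.
have f0 : f 0 = 0 by rewrite -(subrr 0) fM subrr.
have fD x y : f (x + y) = f x + f y.
  by rewrite -{1}[y]opprK fM -[- y]add0r fM f0 sub0r opprK.
have E x n : f x *+ (n %% a.-1.+1) = f x *+ n by rewrite prednK // mulrn_modn.
have bf : biadditive (fun (x : X) (c : Zmod a) => f x *+ c).
  split=> [x y c|x b c]; first by rewrite fD mulrnDl.
  by rewrite -mulrnDr -[RHS]E.
have [g [[_ gf] _]] := tensor_universal bf; exists g; apply/funext => x /=.
by rewrite gf; exact/esym/(E x 1%N).
Qed.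

Lemma tensor_finite : finitely_generated X ->
  exists2 H : finZmodType, zmod_iso T H & exponent_dvd a H.
Proof.
move=> [r [g hg]].
(* Multiples by a vanish, so combinations of the r generators with coefficients in 0, ..., a-1
   exhaust the tensor product. *)
pose s : seq T := [seq \sum_(i < r) tensor1 (g i) *+ c i | c : {ffun 'I_r -> 'I_a}].
have mem_s t : t \in s.
  have [x ->] := tensor1_surj t; have [c ->] := hg x.
  pose c' : {ffun 'I_r -> 'I_a} := [ffun i => Ordinal (ltn_pmod `|(c i %% a)%Z|%N a_gt0)].
  apply/fintype.imageP; exists c' => //; rewrite raddf_sum; apply: eq_bigr => i _.
  rewrite ffunE /= raddfMz (mulrn_modn _ (tensor1_mulrn _)).
  have a0 : (a%:Z != 0) by rewrite -lt0n.
  rewrite {1}(divz_eq (c i) a) mulrzDr [(_ %/ _)%Z * _]mulrC mulrzA.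
  rewrite -pmulrn tensor1_mulrn mul0rz add0r.
  by rewrite pmulrn gez0_abs // modz_ge0.
have [H iH] := finite_zmod_iso mem_s; exists H => //.
apply/exponent_dvdP => y; have [f fM [f' fK f'K]] := iH.
rewrite -[y]f'K; have [x ->] := tensor1_surj (f' y).
pose F : {additive T -> H} := HB.pack f (GRing.isZmodMorphism.Build T H f fM).
by rewrite -[f]/(F : T -> H) -raddfMn tensor1_mulrn raddf0.
Qed.

End TensorQuotient.

Section TensorClass.
Local Open Scope ring_scope.
Variables (a : nat) (I : choiceType) (S : I -> finZmodType).
Hypotheses (a_gt0 : (0 < a)%N) (repsS : iso_class_reps a S).

Lemma tensor_class_exists (A : fgAbGroup) :
  exists i, zmod_iso (tensor A (Zmod a)) (S i).
Proof.
have [H TH aH] := tensor_finite a_gt0 (fg_sortP A).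
have [i [Hi _]] := repsS.2 H aH.
by exists i; exact: zmod_iso_trans TH Hi.
Qed.

Definition tensor_class (A : fgAbGroup) : I := projT1 (cid (tensor_class_exists A)).

Lemma tensor_classP (A : fgAbGroup) : zmod_iso (tensor A (Zmod a)) (S (tensor_class A)).
Proof. exact: projT2 (cid (tensor_class_exists A)). Qed.

Lemma reps_inj i j : zmod_iso (S i) (S j) -> i = j.
Proof.
move=> ij; have [l [_ ul]] := repsS.2 (S i) (repsS.1 i).
by rewrite -(ul i (zmod_iso_refl _)) (ul j ij).
Qed.

Lemma tensor_class_quotient (A : fgAbGroup) : exists q : A -> S (tensor_class A),
  [/\ GRing.zmod_morphism q, forall y, exists x, y = q x &
   forall G : finZmodType, exponent_dvd a G -> forall f : A -> G, GRing.zmod_morphism f ->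
     exists g : S (tensor_class A) -> G, f = g \o q].
Proof.
have [f fM [f' fK f'K]] := tensor_classP A; exists (f \o tensor1 a (X := A)); split.
- by move=> x y /=; rewrite tensor1_morphism fM.
- by move=> y; have [x ex] := tensor1_surj (f' y); exists x; rewrite /= -ex f'K.
move=> G aG h hM; have [g ->] := tensor1_factor a_gt0 aG hM.
by exists (g \o f'); apply/funext => x /=; rewrite fK.
Qed.

Lemma nSur_tensor_class_iso (A B : fgAbGroup) (G : finZmodType) :
  zmod_iso A B -> exponent_dvd a G -> nSur A G = nSur (S (tensor_class B)) G.
Proof.
move=> [f fM [f' fK f'K]] aG; rewrite nSur_surs.
have [q [qM qS qF]] := tensor_class_quotient B.
apply: (@zmod_morphism_Sur_card _ _ _ (q \o f)).
- by move=> x y /=; rewrite fM qM.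
- by move=> y; have [x ->] := qS y; exists (f' x); rewrite /= f'K.
move=> h hM; have [|g hg] := qF G aG (h \o f').
  by move=> x y /=; rewrite -hM; congr h; apply: (can_inj fK); rewrite fM !f'K.
by exists g; apply/funext => x /=; rewrite -[LHS]/(h x) -{1}(fK x) -[LHS]/((h \o f') (f x)) hg.
Qed.

Lemma nSur_tensor_class (A : fgAbGroup) (G : finZmodType) :
  exponent_dvd a G -> nSur A G = nSur (S (tensor_class A)) G.
Proof. exact: nSur_tensor_class_iso (zmod_iso_refl A). Qed.

(** Functoriality of the tensor product is bypassed: both classes receive and emit the same numbers
    of surjections as their groups, so each surjects onto the other, and finite groups that do so
    are isomorphic. *)
Lemma tensor_class_iso (A B : fgAbGroup) :
  zmod_iso A B -> tensor_class A = tensor_class B.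
Proof.
move=> AB; apply: reps_inj.
have E (G : finZmodType) : exponent_dvd a G ->
    nSur (S (tensor_class A)) G = nSur (S (tensor_class B)) G.
  by move=> aG; rewrite -nSur_tensor_class // (nSur_tensor_class_iso AB).
have AB0 : (0 < nSur (S (tensor_class A)) (S (tensor_class B)))%N.
  by rewrite E ?nSur_self_gt0 //; exact: repsS.1.
have BA0 : (0 < nSur (S (tensor_class B)) (S (tensor_class A)))%N.
  by rewrite -E ?nSur_self_gt0 //; exact: repsS.1.
apply: nSur_gt0_iso => //; apply/eqP.
by rewrite eqn_leq !nSur_gt0_leq.
Qed.

Lemma tensor_class_eq (A : fgAbGroup) (i : I) :
  zmod_iso (tensor A (Zmod a)) (S i) <-> tensor_class A = i.
Proof.
split=> [Ai|<-]; last exact: tensor_classP.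
by apply: reps_inj; apply: zmod_iso_trans (zmod_iso_sym (tensor_classP A)) Ai.
Qed.

End TensorClass.

(** * Random groups as laws on representatives *)

Section GroupLaw.
Local Open Scope classical_set_scope.
Local Open Scope ring_scope.
Variables (R : realType) (a : nat) (I : choiceType) (S : I -> finZmodType).
Hypotheses (a_gt0 : (0 < a)%N) (repsS : iso_class_reps a S).
Variables (d : measure_display) (T : measurableType d) (P : probability T R).
Variables (X : T -> fgAbGroup) (rX : random_group X).

Let cls w : I := tensor_class a_gt0 repsS (X w).

(** Any condition on the class is isomorphism invariant by [tensor_class_iso], hence measurable for
    a random group. *)
Lemma measurable_class (f : I -> R) : measurable_fun [set: T] (f \o cls).
Proof.
move=> _ B _; rewrite setTI; apply: (rX (C := fun A => B (f (tensor_class a_gt0 repsS A)))).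
by move=> A A' AA'; rewrite (tensor_class_iso a_gt0 repsS AA').
Qed.

Let sm (f : I -> R) := P.-integrable [set: T] (EFin \o (f \o cls)).
Let mn (f : I -> R) : R := \int[P]_(w in [set: T]) (f (cls w)).

Lemma group_has_mean_le f g : sm g -> (forall i, `|f i| <= `|g i|) -> sm f.
Proof.
move=> sg fg; apply: le_integrable sg => //.
  exact/measurable_EFinP/measurable_class.
by move=> w _ /=; rewrite lee_fin.
Qed.

Lemma group_has_meanD f g : sm f -> sm g -> sm (fun i => f i + g i).
Proof. by move=> sf sg; have := integrableD measurableT sf sg. Qed.

Lemma group_has_meanZ c f : sm f -> sm (fun i => c * f i).
Proof. by move=> sf; have := integrableZl measurableT c sf. Qed.

Lemma group_meanD f g : sm f -> sm g -> mn (fun i => f i + g i) = mn f + mn g.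
Proof. by move=> sf sg; exact: RintegralD. Qed.

Lemma group_meanZ c f : sm f -> mn (fun i => c * f i) = c * mn f.
Proof. by move=> sf; exact: RintegralZl. Qed.

Lemma group_mean_le f g : sm f -> sm g -> (forall i, f i <= g i) -> mn f <= mn g.
Proof. by move=> sf sg fg; apply: le_Rintegral. Qed.

Definition group_law : law R I := Law group_has_mean_le group_has_meanD
  group_has_meanZ group_meanD group_meanZ group_mean_le.

Lemma surj_momentE (G : finZmodType) : exponent_dvd a G ->
  surj_moment P X G = (\int[P]_w ((nSur (S (cls w)) G)%:R)%:E)%E.
Proof.
move=> aG; rewrite /surj_moment unlock; apply: eq_integral => w _.
by rewrite (nSur_tensor_class a_gt0 repsS).
Qed.

Lemma mean_sur (G : finZmodType) : exponent_dvd a G ->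
  mean group_law (fun i => (nSur (S i) G)%:R) = fine (surj_moment P X G).
Proof. by move=> aG; rewrite surj_momentE. Qed.

Lemma has_mean_sur (G : finZmodType) : exponent_dvd a G ->
  surj_moment P X G \is a fin_num ->
  has_mean group_law (fun i => (nSur (S i) G)%:R).
Proof.
move=> aG; rewrite surj_momentE // => fn; apply/integrableP; split.
  by apply/measurable_EFinP; exact: (measurable_class (fun i => (nSur (S i) G)%:R)).
rewrite (eq_integral (fun w => ((nSur (S (cls w)) G)%:R)%:E)) ?ltey_eq ?fn //.
by move=> w _ /=; rewrite ger0_norm.
Qed.

Lemma tensor_probE (H : finZmodType) (i : I) : zmod_iso H (S i) ->
  tensor_prob P X a H = (mean group_law (fun j => (j == i)%:R))%:E.
Proof.
move=> Hi; rewrite /tensor_prob.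
set E := [set w | _].
have EE w : E w <-> cls w = i.
  split=> [Ew|/tensor_class_eq Ew].
    by apply/(tensor_class_eq a_gt0 repsS); exact: zmod_iso_trans Ew Hi.
  exact: zmod_iso_trans Ew (zmod_iso_sym Hi).
have mE : measurable E.
  have -> : E = [set w | tensor_class a_gt0 repsS (X w) = i].
    by apply/seteqP; split=> w /EE.
  apply: (rX (C := fun A => tensor_class a_gt0 repsS A = i)) => A A' AA'.
  by rewrite (tensor_class_iso a_gt0 repsS AA').
rewrite /= /mn /Rintegral.
have -> : (\int[P]_w ((cls w == i)%:R)%:E = \int[P]_w (\1_E w)%:E)%E.
  apply: eq_integral => w _; rewrite indicE; congr ((nat_of_bool _)%:R%:E).
  by apply/idP/idP => [/eqP/EE/mem_set|/set_mem/EE/eqP].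
by rewrite integral_indic // setIT fineK // fin_num_measure.
Qed.

End GroupLaw.

(** * Interleaving of two sequences *)

Section Interleave.
Local Open Scope classical_set_scope.
Local Open Scope ring_scope.

Definition interleave (A : Type) (u v : nat -> A) (n : nat) : A :=
  if odd n then v n./2 else u n./2.

Lemma near_interleave (A : Type) (u v : nat -> A) (B : A -> Prop) :
  (\forall n \near \oo, B (interleave u v n)) <->
  (\forall n \near \oo, B (u n)) /\ (\forall n \near \oo, B (v n)).
Proof.
split=> [[N _ hN]|[[N _ hN] [M _ hM]]].
  split; exists N => // n /= Nn.
    have := hN n.*2; rewrite /interleave /= odd_double doubleK; apply.
    by rewrite /= -addnn (leq_trans Nn) // leq_addr.
  have := hN n.*2.+1; rewrite /interleave /= odd_double /= uphalf_double; apply.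
  by rewrite /= -addnn (leq_trans Nn) // leqW // leq_addr.
exists (N + M)%N.*2 => // n /= NMn; rewrite /interleave.
have h : (N + M <= n./2)%N by rewrite -(doubleK (N + M)%N) half_leq.
case: odd; [apply: hM | apply: hN] => /=; apply: leq_trans h.
  exact: leq_addl.
exact: leq_addr.
Qed.

Lemma tends_interleave (R : realType) (I : Type) (Q1 Q2 : nat -> law R I) f l :
  tends (interleave Q1 Q2) f l <-> tends Q1 f l /\ tends Q2 f l.
Proof.
have E (q1 q2 : nat -> law R I) : (mean (interleave q1 q2 n) f @[n --> \oo] --> l) <->
    (mean (q1 n) f @[n --> \oo] --> l) /\ (mean (q2 n) f @[n --> \oo] --> l).
  split=> [/cvgrPdist_le h|[/cvgrPdist_le h1 /cvgrPdist_le h2]].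
    by split; apply/cvgrPdist_le => e /h
      /(near_interleave q1 q2 (fun q => `|l - mean q f| <= e)) [].
  apply/cvgrPdist_le => e e0.
  by apply/(near_interleave q1 q2 (fun q => `|l - mean q f| <= e)); split; [exact: h1|exact: h2].
rewrite /tends E (near_interleave Q1 Q2 (fun q => has_mean q f)); tauto.
Qed.

End Interleave.

(** * Moments and probabilities as means *)

Section Conclusion.
Local Open Scope classical_set_scope.
Local Open Scope ring_scope.
Variables (R : realType) (k a : nat) (I : choiceType) (S : I -> finZmodType).
Hypotheses (a_gt0 : (0 < a)%N) (repsS : iso_class_reps a S).
Variables (d : nat -> measure_display) (T : forall n, measurableType (d n)).
Variables (P : forall n, probability (T n) R) (X : forall n, T n -> fgAbGroup).
Arguments X : clear implicits.
Hypothesis rX : forall n, random_group (X n).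

Definition group_laws (n : nat) : law R I := group_law a_gt0 repsS (P n) (rX n).

(** Some moments may be infinite; convergence to a finite limit makes them finite eventually, which
    is why [tends] asks for a mean only near infinity. *)
Lemma tends_moment (G : finZmodType) (l : R) : exponent_dvd a G ->
  surj_moment (P n) (X n) G @[n --> \oo] --> l%:E ->
  tends group_laws (fun i => (nSur (S i) G)%:R) l.
Proof.
move=> aG /fine_cvgP[fn cf]; split.
  by near=> n; apply: has_mean_sur => //; near: n.
by under eq_fun do rewrite mean_sur //.
Unshelve. all: by end_near. Qed.

Lemma cvg_tensor_prob (H : finZmodType) (i : I) (l : R) : zmod_iso H (S i) ->
  tends group_laws (fun j => (j == i)%:R) l ->
  tensor_prob (P n) (X n) a H @[n --> \oo] --> l%:E.
Proof.
move=> Hi [_ ml]; under eq_fun do rewrite (tensor_probE a_gt0 repsS _ (rX _) Hi).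
by apply/fine_cvgP; split => //; near=> n.
Unshelve. all: by end_near. Qed.

End Conclusion.

Local Open Scope classical_set_scope.
Local Open Scope ring_scope.
Local Open Scope ereal_scope.

Theorem theorem8p1 (R : realType) (k a : nat) (hk : (0 < k)%N) (ha : (0 < a)%N)
    (dX dY : nat -> measure_display)
    (TX : forall n : nat, measurableType (dX n))
    (TY : forall n : nat, measurableType (dY n))
    (PX : forall n : nat, probability (TX n) R)
    (PY : forall n : nat, probability (TY n) R)
    (X : forall n : nat, TX n -> fgAbGroup)
    (Y : forall n : nat, TY n -> fgAbGroup)
    (rX : forall n : nat, random_group (@X n))
    (rY : forall n : nat, random_group (@Y n))
    (momX : forall G : finZmodType, exponent_dvd a G ->
      surj_moment (PX n) (@X n) G @[n --> \oo] --> (n_chains k G)%:R%:E)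
    (momY : forall G : finZmodType, exponent_dvd a G ->
      surj_moment (PY n) (@Y n) G @[n --> \oo] --> (n_chains k G)%:R%:E) :
  [/\ forall H : finZmodType, exponent_dvd a H ->
        cvgn (fun n => tensor_prob (PX n) (@X n) a H),
      forall (I : choiceType) (S : I -> finZmodType), iso_class_reps a S ->
        forall G : finZmodType, exponent_dvd a G ->
        \esum_(i in [set: I])
           (limn (fun n => tensor_prob (PX n) (@X n) a (S i))
              * (nSur (S i) G)%:R%:E)
        = (n_chains k G)%:R%:E
    & forall H : finZmodType, exponent_dvd a H ->
        cvgn (fun n => tensor_prob (PY n) (@Y n) a H) /\
        limn (fun n => tensor_prob (PX n) (@X n) a H)
        = limn (fun n => tensor_prob (PY n) (@Y n) a H)].
Proof.
have lim_ex (H : finZmodType) : exponent_dvd a H -> exists l : R,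
    (tensor_prob (PX n) (@X n) a H @[n --> \oo] --> l%:E) /\
    (tensor_prob (PY n) (@Y n) a H @[n --> \oo] --> l%:E).
  move=> aH; have [I [S repsS]] := iso_class_reps_exist a.
  have [i [Hi _]] := repsS.2 H aH.
  (* The alternating sequence satisfies the same moment hypothesis, so [tends_indic] yields one
     limit shared by its two halves. *)
  pose Q := interleave (group_laws ha repsS PX rX) (group_laws ha repsS PY rY).
  have mom G : exponent_dvd a G ->
      tends Q (fun i => (nSur (S i) G)%:R)%R (n_chains k G)%:R%R.
    move=> aG; apply/tends_interleave; split.
      exact: tends_moment (momX G aG).
    exact: tends_moment (momY G aG).
  have [l /tends_interleave[tX tY]] := tends_indic hk ha repsS mom i.
  by exists l; split; [exact: cvg_tensor_prob Hi tX|exact: cvg_tensor_prob Hi tY].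
split.
- by move=> H /lim_ex[l [lX _]]; apply/cvg_ex; exists l%:E.
- move=> I S repsS G aG.
  pose Q := group_laws ha repsS PX rX.
  have mom G' : exponent_dvd a G' ->
      tends Q (fun i => (nSur (S i) G')%:R)%R (n_chains k G')%:R%R.
    by move=> aG'; exact: tends_moment (momX G' aG').
  pose L := limit_law Q.
  have limE i : limn (fun n => tensor_prob (PX n) (@X n) a (S i)) = (L i)%:E.
    apply: cvg_lim => //.
    exact: cvg_tensor_prob (zmod_iso_refl _) (limit_lawP hk ha repsS mom i).
  have sumE (A : {fset I}) :
      \sum_(i <- A) (limn (fun n => tensor_prob (PX n) (@X n) a (S i)) * (nSur (S i) G)%:R%:E)
      = (\sum_(i <- A) L i * (nSur (S i) G)%:R)%R%:E.
    by rewrite -sumEFin; apply: eq_bigr => i _; rewrite limE EFinM.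
  (* The sum is a supremum of finite partial sums: each is at most the moment, and for every e > 0
     one of them comes within e of it. *)
  apply/eqP; rewrite eq_le; apply/andP; split.
    apply: ge_ereal_sup => _ [A [finA _] <-].
    by rewrite fsbig_finite // sumE lee_fin (limit_moment_le hk ha repsS mom).
  apply/lee_addgt0Pr => e e0.
  have [A hA] := limit_moment_ge hk ha repsS mom aG e0.
  rewrite -leeBlDr //; apply: esum_ge; exists [set` A]; first by split.
  by rewrite fsbig_finite // set_fsetK sumE -EFinB lee_fin.
- move=> H /lim_ex[l [lX lY]]; split; first by apply/cvg_ex; exists l%:E.
  by rewrite (cvg_lim _ lX) // (cvg_lim _ lY).
Qed.
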